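(* Let $\mu\in\mathbb{R}$, $0\le\rho\le1$, $T>0$ and $\kappa\in\mathbb{R}$ be fixed, and let $M$ be a standard Brownian motion. Let $g(0)\in\mathbb{C}$ and let $$g(t)=g(0)\exp\left(-\tfrac12(1-\rho)\kappa^2 t-i\kappa(\mu t+\sqrt{\rho}\,M_t)\right)$$ be the amplitude of the exact Fourier mode $g(t)\exp(i\kappa x)$ of the SPDE $\mathrm{d}v=-\mu v_x\,\mathrm{d}t+\frac12 v_{xx}\,\mathrm{d}t-\sqrt{\rho}\,v_x\,\mathrm{d}M_t$ on $\mathbb{R}$. For timestep $k>0$ with $T/k\in\mathbb{N}$ and grid spacing $h>0$, let $g_n$ be the amplitude of the corresponding Fourier mode of the Milstein finite difference scheme, i.e. $v_j^n=g_n\exp(i\kappa jh)$, $g_0=g(0)$, satisfies $$v_j^{n+1}=v_j^n-\frac{\mu k+\sqrt{\rho k}\,Z_n}{2h}\left(v_{j+1}^n-v_{j-1}^n\right)+\frac{(1-\rho)k+\rho kZ_n^2}{2h^2}\left(v_{j+1}^n-2v_j^n+v_{j-1}^n\right),\qquad j\in\mathbb{Z},$$ with $\sqrt{k}\,Z_n=M_{(n+1)k}-M_{nk}$. Then the root-mean-square error in the Fourier mode over the full simulation interval is of first order in $k$ and second order in $h$: there exist constants $c,k_0,h_0>0$ (depending on $\kappa,\mu,\rho,T,g(0)$ but not on $k,h$) such that for all $0<k\le k_0$ with $T/k\in\mathbb{N}$ and all $0<h\le h_0$, $$\left(\mathbb{E}\left[\,|g_{T/k}-g(T)|^2\right]\right)^{1/2}\le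 c\,(k+h^2).$$
   Context: The discretisation is considered on an unbounded domain, without boundary conditions; $v_j^n$ approximates $v(nk,jh)$. The discrete and exact modes are driven by the same Brownian path, so the $Z_n$ are independent standard normal random variables. *)

(* Defs.v *)
From HB Require Import structures.
From mathcomp Require Import all_boot all_order all_algebra finmap.
From mathcomp Require Import all_classical all_reals all_analysis.
From mathcomp.real_closed Require Export complex.
Set Implicit Arguments.
Unset Strict Implicit.
Unset Printing Implicit Defensive.
Import Order.TTheory GRing.Theory Num.Theory.
Import numFieldNormedType.Exports.
Local Open Scope classical_set_scope.
Local Open Scope ring_scope.
Local Open Scope complex_scope.

(* Meaningful for a family of measurable X i. *)
Definition mutually_independent (d : measure_display) (Omega : measurableType d)
    (R : realType) (P : probability Omega R) (I : choiceType)
    (X : I -> Omega -> R) : Prop :=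
  forall (J : {fset I}) (A : I -> set R), (forall i, measurable (A i)) ->
    P (\bigcap_(i in [set` J]) (X i @^-1` A i))
    = (\prod_(i <- J) P (X i @^-1` A i))%E.

(* Only the times t >= 0 are constrained. The Gaussian clause asks for s < t
   because [normal_prob m 0] is not the Dirac mass at m in the library. A
   finite partition t_0 <= ... <= t_n extends to an infinite nondecreasing
   sequence of times, hence the formulation of independent increments. *)
Definition standard_brownian_motion (d : measure_display)
    (Omega : measurableType d) (R : realType) (P : probability Omega R)
    (M : R -> {RV P >-> R}) : Prop :=
  [/\ {ae P, forall w, M 0 w = 0},
      (forall t : nat -> R, 0 <= t 0%N -> nondecreasing_seq t ->
        mutually_independent P (fun (i : nat) w => M (t i.+1) w - M (t i) w)),
      (forall s t : R, 0 <= s -> s < t ->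
        forall A : set R, measurable A ->
        P ((fun w => M t w - M s w) @^-1` A)
        = normal_prob 0 (Num.sqrt (t - s)) A) &
      {ae P, forall w, {within `[0, +oo[, continuous (fun t : R => M t w)}}].

Arguments standard_brownian_motion {d Omega R} P M.

(* complex exponential, e^(a + i b) = e^a (cos b + i sin b) *)
Definition cexp (R : realType) (z : R[i]) : R[i] :=
  let: a +i* b := z in (expR a * cos b) +i* (expR a * sin b).

(* g(t), as a function of t and of the value m = M_t *)
Definition exact_amplitude (R : realType) (mu rho kappa : R) (g0 : R[i])
    (t m : R) : R[i] :=
  g0 * cexp ((- (2^-1 * (1 - rho) * kappa ^+ 2 * t))
             -i* (kappa * (mu * t + Num.sqrt rho * m))).

(* The finite difference scheme along one path: z n is the normalised Brownian
   increment of step n and v n j the approximation at time n k and point j h. *)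
Definition milstein_scheme (R : realType) (mu rho k h : R) (z : nat -> R)
    (v : nat -> int -> R[i]) : Prop :=
  forall (n : nat) (j : int),
    v n.+1 j = v n j
      - ((mu * k + Num.sqrt (rho * k) * z n) / (2 * h))%:C
        * (v n (j + 1) - v n (j - 1))
      + (((1 - rho) * k + rho * k * z n ^+ 2) / (2 * h ^+ 2))%:C
        * (v n (j + 1) - 2 * v n j + v n (j - 1)).

Definition fourier_mode (R : realType) (kappa h : R) (g : R[i]) (j : int) :
    R[i] :=
  g * cexp (0 +i* (kappa * j%:~R * h)).

(* Main.v *)
(** One step of the scheme multiplies the Fourier mode by a random factor A, one
step of the exact solution by a factor E, both functions of the Brownian
increment x of law N(0, k). The increments being independent and E having
constant modulus, the mean-square error after N steps is |g0|^2 times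

    a^N - 2 Re b^N + c^N,   a = E|A|^2,  b = E[A conj(E)],  c = |E|^2,

so only two one-step quantities matter: with delta = k + h^2,

    a - 2 Re b + c = E|A - E|^2 = O(k delta^2),
    b - c = E[(A - E) conj(E)] = O(k delta).

Pathwise A - E is only O(k^(1/2) delta); the second estimate gains a factor
k^(1/2) because the leading part of A - E is odd in x and x is symmetric. A
discrete Gronwall argument on the recursion satisfied by the expression above
then bounds it by a multiple of delta^2. *)

Require Import Defs.
From HB Require Import structures.
From mathcomp Require Import all_boot all_order all_algebra.
From mathcomp Require Import all_classical all_reals all_analysis.
From mathcomp Require Import measurable_realfun finmap ring lra.
Import Order.TTheory GRing.Theory Num.Theory.
Import numFieldNormedType.Exports.
Import ComplexField.Normc.
Local Open Scope classical_set_scope.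
Local Open Scope ring_scope.
Local Open Scope complex_scope.

Set Implicit Arguments.
Unset Strict Implicit.

(** * Elementary inequalities *)

(** Adding up T/k errors of size k^(1/2) delta by the triangle inequality would only give k^(-1/2)
    delta. In the expanded square, each step contributes k delta^2 directly and a cross term (k
    delta)(n k delta), where n k is at most T, so the total is O(delta^2). The size of A - E rests
    on the Milstein term: rho x^2 kappa^2 / 2 matches the quadratic term of cos(phase) pathwise, so
    nothing of order k survives and the time error starts at k^(3/2). As kappa is fixed, the
    discrete symbols stay bounded, and no relation between k and h is needed. The increments are
    unbounded, so the Taylor estimates hold with weights polynomial in |x| / k^(1/2). All of these
    are dominated by one Gaussian exponential whose mean does not depend on k, which makes the
    constants uniform. *)

Lemma norm_sin_le (R : realType) (x : R) : `|sin x| <= `|x|.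
Proof.
wlog x0 : x / 0 <= x.
  move=> H; have [x0|/ltW x0] := lerP 0 x; first exact: H.
  by have := H (- x); rewrite sinN !normrN; apply; rewrite oppr_ge0.
have [c _] := MVT_segment x0 (fun y _ => is_derive_sin y)
  (continuous_subspaceT (@continuous_sin R)).
rewrite sin0 !subr0 => ->.
by rewrite normrM ler_piMl// cos_max.
Qed.

Lemma onem_cosE (R : realType) (x : R) : 1 - cos x = 2 * sin (x / 2) ^+ 2.
Proof.
have {1}-> : x = (x / 2) *+ 2 by rewrite -mulr_natr divfK.
by rewrite cos_mulr2n; have := cos2Dsin2 (x / 2); lra.
Qed.

Lemma onem_cos_bound (R : realType) (x : R) : 0 <= 1 - cos x <= x ^+ 2 / 2.
Proof.
rewrite onem_cosE; apply/andP; split; first by rewrite mulr_ge0 ?sqr_ge0.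
rewrite [leRHS](_ : _ = 2 * (x / 2) ^+ 2); last by field.
rewrite ler_pM2l// -[leLHS]real_normK ?num_real// -[leRHS]real_normK ?num_real//.
by rewrite lerXn2r ?nnegrE ?normr_ge0 ?norm_sin_le.
Qed.

(** The mean value theorem for sin z - z raises the quadratic bound on 1 - cos by one order. The
    constant 1/2 is not sharp; only the order matters. *)
Lemma norm_sinBid_le (R : realType) (x : R) : `|sin x - x| <= `|x| ^+ 3 / 2.
Proof.
wlog x0 : x / 0 <= x.
  move=> H; have [x0|/ltW x0] := lerP 0 x; first exact: H.
  by have := H (- x); rewrite sinN -opprD !normrN; apply; rewrite oppr_ge0.
have dsinB (y : R) : is_derive y (1 : R) (fun z : R => sin z - z) (cos y - 1).
  by apply: is_deriveB.
have csinB : continuous (fun z : R => sin z - z).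
  by move=> y; apply: cvgB; [exact: continuous_sin|exact: cvg_id].
have [c] := MVT_segment x0 (fun y _ => dsinB y) (continuous_subspaceT csinB).
rewrite in_itv/= => /andP[c0 cx].
rewrite sin0 !subr0 => ->.
rewrite normrM exprSr mulrAC ler_wpM2r ?normr_ge0//.
have /andP[h0 h1] := onem_cos_bound c.
rewrite distrC ger0_norm// (le_trans h1)// ler_wpM2r// ger0_norm//.
by rewrite lerXn2r ?nnegrE.
Qed.

(** By the half-angle formula the remainder is 2 (sin^2(x/2) - (x/2)^2), a difference of squares
    whose factors are of order 3 and 1. *)
Lemma norm_cos_taylor2_le (R : realType) (x : R) :
  `|1 - cos x - x ^+ 2 / 2| <= `|x| ^+ 4 / 8.
Proof.
have -> : 1 - cos x - x ^+ 2 / 2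
    = 2 * ((sin (x / 2) - x / 2) * (sin (x / 2) + x / 2)).
  by rewrite onem_cosE; field.
have h1 := norm_sinBid_le (x / 2).
have h2 : `|sin (x / 2) + x / 2| <= 2 * `|x / 2|.
  by rewrite (le_trans (ler_normD _ _))// mulr_natl mulr2n lerD2r norm_sin_le.
rewrite normrM [ `|2|]ger0_norm// normrM.
apply: (@le_trans _ _ (2 * ((`|x / 2| ^+ 3 / 2) * (2 * `|x / 2|)))).
  by rewrite ler_pM2l// ler_pM.
by rewrite normrM [ `|2^-1|]ger0_norm// le_eqVlt; apply/orP; left; apply/eqP; field.
Qed.

Lemma expRN_bound (R : realType) (a : R) : 0 <= a ->
  [/\ 0 <= 1 - expR (- a), 1 - expR (- a) <= a &
      `|1 - a - expR (- a)| <= a ^+ 2].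
Proof.
move=> a0.
have h1 : expR (- a) <= 1 by rewrite -expR0 ler_expR oppr_le0.
have h2 := expR_ge1Dx (- a).
have h3 := expR_ge1Dx a.
have h4 : expR a * expR (- a) = 1 by rewrite expRN mulfV// gt_eqF ?expR_gt0.
have h5 := expR_gt0 (- a).
split; [lra|lra|].
rewrite distrC ger0_norm; last lra.
have h6 : (1 + a) * expR (- a) <= 1 by rewrite -[leRHS]h4 ler_wpM2r// ltW.
have h7 : 0 < 1 + a by lra.
have h8 : 0 <= a ^+ 3 by rewrite exprn_ge0.
(* The bound used is e^(-a) <= 1/(1 + a) <= 1 - a + a^2, the second inequality from (1 + a)(1 - a +
   a^2) = 1 + a^3. *)
rewrite lerBlDr -(ler_pM2l h7) (le_trans h6)//.
rewrite (_ : (1 + a) * _ = 1 + a ^+ 3); [lra|ring].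
Qed.

(** In this and the following lemmas the bounds are free variables: applied along the shape of an
    expression, under a [le_trans] with an open middle term, they let unification assemble its upper
    bound. *)
Lemma norm_mul_le (R : realDomainType) (a b x y : R) :
  `|a| <= x -> `|b| <= y -> `|a * b| <= x * y.
Proof. by move=> ? ?; rewrite normrM ler_pM. Qed.

Lemma norm_add_le (R : numDomainType) (a b x y : R) :
  `|a| <= x -> `|b| <= y -> `|a + b| <= x + y.
Proof. by move=> ? ?; rewrite (le_trans (ler_normD _ _))// lerD. Qed.

Lemma norm_exp_le (R : realDomainType) (a x : R) n :
  `|a| <= x -> `|a ^+ n| <= x ^+ n.
Proof.
by move=> ax; rewrite normrX lerXn2r ?nnegrE// (le_trans _ ax).
Qed.

Lemma onem_cos_le (R : realType) (x y : R) :
  `|x| <= y -> `|1 - cos x| <= y ^+ 2 / 2.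
Proof.
move=> xy; have /andP[c0 c1] := onem_cos_bound x.
rewrite ger0_norm// (le_trans c1)// ler_pM2r// -real_normK ?num_real//.
by rewrite lerXn2r ?nnegrE// (le_trans _ xy).
Qed.

Lemma sinBid_le (R : realType) (x y : R) :
  `|x| <= y -> `|sin x - x| <= y ^+ 3 / 2.
Proof.
move=> xy; rewrite (le_trans (norm_sinBid_le x))// ler_pM2r//.
by rewrite lerXn2r ?nnegrE// (le_trans _ xy).
Qed.

Lemma cos_taylor2_le (R : realType) (x y : R) :
  `|x| <= y -> `|1 - cos x - x ^+ 2 / 2| <= y ^+ 4 / 8.
Proof.
move=> xy; rewrite (le_trans (norm_cos_taylor2_le x))// ler_pM2r//.
by rewrite lerXn2r ?nnegrE// (le_trans _ xy).
Qed.

(** * Pointwise estimates for one step *)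

Section step_multipliers.
Variables (R : realType) (mu rho kappa k h : R).

(* The first and second difference quotients of the scheme multiply the mode
   exp(i kappa x) by [i * sin_symbol] and [- cos_symbol]. *)
Definition sin_symbol : R := sin (kappa * h) / h.
Definition cos_symbol : R := (1 - cos (kappa * h)) / h ^+ 2.

(** Here x is the unnormalised increment k^(1/2) Z, hence rho x^2 for the rho k Z^2 of the
    scheme. *)
Definition step_re (x : R) : R :=
  1 - cos_symbol * ((1 - rho) * k + rho * x ^+ 2).
Definition step_im (x : R) : R :=
  - (sin_symbol * (mu * k + Num.sqrt rho * x)).

Definition damping : R := expR (- (2^-1 * (1 - rho) * kappa ^+ 2 * k)).
Definition phase (x : R) : R := kappa * (mu * k + Num.sqrt rho * x).

Definition err_re (x : R) : R := step_re x - damping * cos (phase x).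
(** The exact multiplier is damping times exp(-i phase), hence the plus sign. *)
Definition err_im (x : R) : R := step_im x + damping * sin (phase x).

Definition step_sqr (x : R) : R := step_re x ^+ 2 + step_im x ^+ 2.

(* Real and imaginary parts of the scheme's multiplier times the conjugate of
   the exact one. *)
Definition step_cross_re (x : R) : R :=
  step_re x * (damping * cos (phase x)) - step_im x * (damping * sin (phase x)).
Definition step_cross_im (x : R) : R :=
  step_re x * (damping * sin (phase x)) + step_im x * (damping * cos (phase x)).

End step_multipliers.

(* B dominates |kappa|, |mu| and the normalised increment |x| / q, with q the
   square root of k; every term of the Taylor expansions is then bounded by a
   monomial in B, q and h^2. *)
Section step_estimates.
Variables (R : realType) (mu rho kappa k h q x B : R).
Hypotheses (rho_ge0 : 0 <= rho) (rho_le1 : rho <= 1).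
Hypotheses (q_ge0 : 0 <= q) (q_le1 : q <= 1) (kE : k = q ^+ 2).
Hypotheses (h_gt0 : 0 < h).
Hypotheses (B_ge1 : 1 <= B) (kappaB : `|kappa| <= B) (muB : `|mu| <= B).
Hypothesis (xB : `|x| <= q * B).

Let delta := k + h ^+ 2.

Let B_ge0 : 0 <= B. Proof. exact: le_trans B_ge1. Qed.

(** A factor delta is extracted either from h^2 (here) or, in [monomial_k], from two powers of q.
    The remaining exponents are then made uniform: those of B may grow since B >= 1, those of q may
    shrink since q <= 1. *)
Let monomial_h i j n a : (i <= n)%N -> (a <= j)%N ->
  B ^+ i * (q ^+ j * h ^+ 2) <= B ^+ n * (q ^+ a * delta).
Proof.
move=> iln alj; rewrite ler_pM ?mulr_ge0 ?exprn_ge0//.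
- exact: ltW.
- exact: ltW.
- exact: ler_weXn2l.
- rewrite ler_pM ?exprn_ge0// ?(ltW h_gt0)//; first exact: ler_wiXn2l.
  by rewrite /delta kE lerDr sqr_ge0.
Qed.

Let monomial_k i j n a : (i <= n)%N -> (a.+2 <= j)%N ->
  B ^+ i * q ^+ j <= B ^+ n * (q ^+ a * delta).
Proof.
move=> iln alj; rewrite ler_pM ?exprn_ge0//; first exact: ler_weXn2l.
apply: (@le_trans _ _ (q ^+ a.+2)); first exact: ler_wiXn2l.
rewrite -addn2 exprD ler_wpM2l ?exprn_ge0//.
by rewrite /delta kE lerDl sqr_ge0.
Qed.

Let monomial_ge0 n a : 0 <= B ^+ n * (q ^+ a * delta).
Proof.
by rewrite !mulr_ge0 ?exprn_ge0// addr_ge0 ?sqr_ge0// kE sqr_ge0.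
Qed.

Let sqrt_rho : `|Num.sqrt rho| <= 1.
Proof.
by rewrite ger0_norm ?sqrtr_ge0// -[leRHS]sqrtr1 ler_sqrt.
Qed.

Let norm_q : `|q| <= q. Proof. by rewrite ger0_norm. Qed.

Lemma sin_symbol_near : `|kappa - sin_symbol kappa h| <= B ^+ 3 * h ^+ 2.
Proof.
have -> : kappa - sin_symbol kappa h = - (sin (kappa * h) - kappa * h) / h.
  by rewrite /sin_symbol; field; rewrite gt_eqF.
rewrite normrM normrN normfV (gtr0_norm h_gt0) ler_pdivrMr//.
rewrite (le_trans (norm_sinBid_le _))// normrM (gtr0_norm h_gt0).
have -> : B ^+ 3 * h ^+ 2 * h = (B * h) ^+ 3 by ring.
rewrite ler_pdivrMr// (@le_trans _ _ ((B * h) ^+ 3))//.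
  by rewrite lerXn2r ?nnegrE ?mulr_ge0// ?(ltW h_gt0)// ler_pM2r.
by rewrite ler_peMr ?ler1n// exprn_ge0// mulr_ge0// ltW.
Qed.

Lemma cos_symbol_near :
  `|kappa ^+ 2 / 2 - cos_symbol kappa h| <= B ^+ 4 * h ^+ 2.
Proof.
have -> : kappa ^+ 2 / 2 - cos_symbol kappa h
    = - (1 - cos (kappa * h) - (kappa * h) ^+ 2 / 2) / h ^+ 2.
  by rewrite /cos_symbol; field; rewrite gt_eqF.
have h2 : 0 < h ^+ 2 by rewrite exprn_gt0.
rewrite normrM normrN normfV (gtr0_norm h2) ler_pdivrMr//.
rewrite (le_trans (norm_cos_taylor2_le _))// normrM (gtr0_norm h_gt0).
have -> : B ^+ 4 * h ^+ 2 * h ^+ 2 = (B * h) ^+ 4 by ring.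
rewrite ler_pdivrMr// (@le_trans _ _ ((B * h) ^+ 4))//.
  by rewrite lerXn2r ?nnegrE ?mulr_ge0// ?(ltW h_gt0)// ler_pM2r.
by rewrite ler_peMr ?ler1n// exprn_ge0// mulr_ge0// ltW.
Qed.

Let rate := 2^-1 * (1 - rho) * kappa ^+ 2 * k.

Let rate_bound : 0 <= rate <= B ^+ 2 * q ^+ 2.
Proof.
have k0 : 0 <= k by rewrite kE sqr_ge0.
have kap : kappa ^+ 2 <= B ^+ 2.
  by rewrite -real_normK ?num_real// lerXn2r ?nnegrE.
have r0 : 0 <= 2^-1 * (1 - rho) <= 1.
  by apply/andP; split; move: rho_ge0 rho_le1 => ? ?; lra.
have kap0 := sqr_ge0 kappa.
rewrite /rate -mulrA; apply/andP; split.
  by case/andP: r0 => r0 _; apply: mulr_ge0 => //; apply: mulr_ge0.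
case/andP: r0 => r0 r1; rewrite -[leRHS]mul1r; apply: ler_pM => //.
  exact: mulr_ge0.
by rewrite -kE ler_wpM2r.
Qed.

Let damping_bound :
  [/\ `|1 - damping rho kappa k| <= B ^+ 2 * q ^+ 2,
      `|1 - rate - damping rho kappa k| <= B ^+ 4 * q ^+ 4 &
      `|damping rho kappa k| <= 1].
Proof.
have /andP[r0 r1] := rate_bound; have [d0 d1 d2] := expRN_bound r0.
rewrite /damping -/rate; split.
- by rewrite ger0_norm// (le_trans d1).
- rewrite (le_trans d2)//.
  have -> : B ^+ 4 * q ^+ 4 = (B ^+ 2 * q ^+ 2) ^+ 2 by ring.
  by rewrite lerXn2r ?nnegrE// mulr_ge0 ?exprn_ge0.
- by rewrite ger0_norm ?expR_ge0//; lra.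
Qed.

(** The phase is split by order and parity: [drift] is of order q^2 and independent of x, [noise] is
    of order q and odd in x. *)
Let drift := kappa * (mu * k).
Let noise := kappa * (Num.sqrt rho * x).

Let phaseE : phase mu rho kappa k x = drift + noise.
Proof. by rewrite /phase /drift /noise mulrDr. Qed.

Let drift_bound : `|drift| <= B ^+ 2 * q ^+ 2.
Proof.
have -> : B ^+ 2 * q ^+ 2 = B * (B * q ^+ 2) by ring.
by do 2 apply: norm_mul_le => //; rewrite kE normrX lerXn2r ?nnegrE.
Qed.

Let noise_bound : `|noise| <= B ^+ 2 * q.
Proof.
have -> : B ^+ 2 * q = B * (1 * (q * B)) by ring.
by do 2 apply: norm_mul_le => //.
Qed.

Let increment_bound : `|mu * k + Num.sqrt rho * x| <= 2 * (B * q).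
Proof.
rewrite mulr_natl mulr2n; apply: norm_add_le.
  apply: norm_mul_le => //.
  by rewrite kE ger0_norm ?sqr_ge0// expr2 ler_piMr.
by rewrite -[B * q]mul1r; apply: norm_mul_le => //; rewrite mulrC.
Qed.

Let phase_bound : `|phase mu rho kappa k x| <= 2 * (B ^+ 2 * q).
Proof.
have -> : 2 * (B ^+ 2 * q) = B * (2 * (B * q)) by ring.
exact: norm_mul_le.
Qed.

Let variance_bound : `|(1 - rho) * k + rho * x ^+ 2| <= B ^+ 2 * q ^+ 2.
Proof.
have x2 : x ^+ 2 <= B ^+ 2 * q ^+ 2.
  rewrite -exprMn -[leLHS]real_normK ?num_real// lerXn2r ?nnegrE//.
    exact: mulr_ge0.
  by rewrite mulrC.
have k2 : k <= B ^+ 2 * q ^+ 2.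
  by rewrite kE ler_peMl ?sqr_ge0// exprn_ege1.
have k0 : 0 <= k by rewrite kE sqr_ge0.
have := sqr_ge0 x => x0.
rewrite ger0_norm; last by rewrite addr_ge0// mulr_ge0// subr_ge0.
have := lerD (ler_wpM2l (_ : 0 <= 1 - rho) k2) (ler_wpM2l rho_ge0 x2).
by rewrite subr_ge0 => /(_ rho_le1); lra.
Qed.


(** All terms of order k cancel, because kappa^2/2 times the variance term of the scheme is exactly
    [rate] + [noise]^2/2. What remains is the spatial error, the remainders of the exponential and
    of the cosine, and the part of phase^2/2 containing [drift], whose largest term drift * noise is
    of order q^3. *)
Lemma err_re_bound :
  `|err_re mu rho kappa k h x| <= 20 * (B ^+ 8 * (q ^+ 1 * delta)).
Proof.
have [d1 d2 d3] := damping_bound.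
have ph := phase_bound; have sr2 : Num.sqrt rho ^+ 2 = rho by rewrite sqr_sqrtr.
pose th := phase mu rho kappa k x; pose r := damping rho kappa k.
have -> : err_re mu rho kappa k h x =
    (kappa ^+ 2 / 2 - cos_symbol kappa h) * ((1 - rho) * k + rho * x ^+ 2)
    + ((1 - rate - r) + ((drift ^+ 2 + 2 * (drift * noise)) / 2
    + (- ((1 - r) * (th ^+ 2 / 2)) + r * (1 - cos th - th ^+ 2 / 2)))).
  rewrite /err_re /step_re -/th -/r /th phaseE /rate.
  by rewrite -[in LHS]sr2 -[in RHS]sr2 /drift /noise; field.
refine (le_trans _ _).
  apply: norm_add_le; first exact: norm_mul_le cos_symbol_near variance_bound.
  apply: norm_add_le; first exact: d2.
  apply: norm_add_le.
    apply: norm_mul_le; last exact: lexx.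
    apply: norm_add_le; first exact: norm_exp_le drift_bound.
    apply: norm_mul_le; first exact: lexx.
    exact: norm_mul_le drift_bound noise_bound.
  apply: norm_add_le.
    rewrite normrN; apply: norm_mul_le d1 _.
    by apply: norm_mul_le; [exact: norm_exp_le ph|exact: lexx].
  apply: norm_mul_le d3 _.
  exact: cos_taylor2_le ph.
rewrite [ `|2|]ger0_norm// [ `|2^-1|]ger0_norm//.
(* The power B^8 comes from the fourth-order cosine remainder. The coefficients add up to 7.5; the
   constant 20 is a margin common to the four error bounds. *)
have m0 := monomial_ge0 8 1.
have m1 := @monomial_h 6 2 8 1 isT isT.
have m2 := @monomial_k 4 4 8 1 isT isT.
have m3 := @monomial_k 4 3 8 1 isT isT.
have m4 := @monomial_k 6 4 8 1 isT isT.
have m5 := @monomial_k 8 4 8 1 isT isT.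
lra.
Qed.

(** To first order both multipliers are linear in the increment, with slopes differing by
    [kappa - sin_symbol]. The sine remainder and the damping defect times the sine are of order
    q^3. *)
Lemma err_im_bound :
  `|err_im mu rho kappa k h x| <= 20 * (B ^+ 8 * (q ^+ 1 * delta)).
Proof.
have [d1 d2 d3] := damping_bound.
have ph := phase_bound.
pose th := phase mu rho kappa k x; pose r := damping rho kappa k.
have -> : err_im mu rho kappa k h x =
    (kappa - sin_symbol kappa h) * (mu * k + Num.sqrt rho * x)
    + ((sin th - th) + - ((1 - r) * sin th)).
  by rewrite /err_im /step_im -/th -/r {2 3}/th /phase; ring.
refine (le_trans _ _).
  apply: norm_add_le; first exact: norm_mul_le sin_symbol_near increment_bound.
  apply: norm_add_le.
    exact: sinBid_le ph.
  rewrite normrN; apply: norm_mul_le d1 _.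
  exact: le_trans (norm_sin_le _) ph.
have m0 := monomial_ge0 8 1.
have m1 := @monomial_h 4 1 8 1 isT isT.
have m2 := @monomial_k 6 3 8 1 isT isT.
have m3 := @monomial_k 4 3 8 1 isT isT.
lra.
Qed.

(** With [exact_im_near0] this says E = 1 + O(q), so replacing (A - E) conj(E) by A - E costs only
    O(q^2 delta). *)
Lemma exact_re_near1 :
  `|damping rho kappa k * cos (phase mu rho kappa k x) - 1| <= 5 * (B ^+ 4 * q).
Proof.
have [d1 d2 d3] := damping_bound.
have ph := phase_bound.
pose th := phase mu rho kappa k x; pose r := damping rho kappa k.
have -> : r * cos th - 1 = - ((1 - r) * cos th) + - (1 - cos th) by ring.
refine (le_trans _ _).
  apply: norm_add_le.
    by rewrite normrN; apply: norm_mul_le d1 (cos_max _).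
  by rewrite normrN; exact: onem_cos_le ph.
have b24 : B ^+ 2 <= B ^+ 4 by exact: ler_weXn2l.
have q21 : q ^+ 2 <= q by rewrite expr2 ler_piMr.
have m1 : B ^+ 2 * q ^+ 2 <= B ^+ 4 * q by rewrite ler_pM ?exprn_ge0.
have m2 : B ^+ 4 * q ^+ 2 <= B ^+ 4 * q by rewrite ler_wpM2l ?exprn_ge0.
have m3 : 0 <= B ^+ 4 * q by rewrite mulr_ge0 ?exprn_ge0.
lra.
Qed.

Lemma exact_im_near0 :
  `|damping rho kappa k * sin (phase mu rho kappa k x)| <= 5 * (B ^+ 4 * q).
Proof.
have [_ _ d3] := damping_bound.
have ph := phase_bound.
refine (le_trans _ _); first exact: norm_mul_le d3 (le_trans (norm_sin_le _) ph).
have b24 : B ^+ 2 <= B ^+ 4 by exact: ler_weXn2l.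
have m1 : B ^+ 2 * q <= B ^+ 4 * q by rewrite ler_wpM2r.
have m2 : 0 <= B ^+ 4 * q by rewrite mulr_ge0 ?exprn_ge0.
lra.
Qed.

Let phaseN : phase mu rho kappa k (- x) = drift - noise.
Proof. by rewrite /phase /drift /noise; ring. Qed.

(* The part odd in x cancels, which gains a factor q over [err_re_bound]. *)
Lemma err_re_sym_bound :
  `|err_re mu rho kappa k h x + err_re mu rho kappa k h (- x)|
    <= 2 * (20 * (B ^+ 8 * (q ^+ 2 * delta))).
Proof.
have [d1 d2 d3] := damping_bound.
have sr2 : Num.sqrt rho ^+ 2 = rho by rewrite sqr_sqrtr.
pose r := damping rho kappa k.
have -> : err_re mu rho kappa k h x + err_re mu rho kappa k h (- x) = 2 *
    ((kappa ^+ 2 / 2 - cos_symbol kappa h) * ((1 - rho) * k + rho * x ^+ 2)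
    + ((1 - rate - r) + (r * (cos noise * (1 - cos drift))
    + (- ((1 - r) * (noise ^+ 2 / 2))
       + r * (1 - cos noise - noise ^+ 2 / 2))))).
  rewrite /err_re /step_re -/r phaseN phaseE cosD cosB /rate.
  by rewrite -[in LHS]sr2 -[in RHS]sr2 /noise; field.
apply: norm_mul_le; first by rewrite ger0_norm.
refine (le_trans _ _).
  apply: norm_add_le; first exact: norm_mul_le cos_symbol_near variance_bound.
  apply: norm_add_le; first exact: d2.
  apply: norm_add_le.
    apply: norm_mul_le d3 _; apply: norm_mul_le; first exact: cos_max.
    exact: onem_cos_le drift_bound.
  apply: norm_add_le.
    rewrite normrN; apply: norm_mul_le d1 _.
    by apply: norm_mul_le; [exact: norm_exp_le noise_bound|exact: lexx].
  apply: norm_mul_le d3 _.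
  exact: cos_taylor2_le noise_bound.
rewrite [ `|2^-1|]ger0_norm//.
have m0 := monomial_ge0 8 2.
have m1 := @monomial_h 6 2 8 2 isT isT.
have m2 := @monomial_k 4 4 8 2 isT isT.
have m4 := @monomial_k 6 4 8 2 isT isT.
have m5 := @monomial_k 8 4 8 2 isT isT.
lra.
Qed.

(** Symmetrising turns sin(phase) into 2 sin(drift) cos(noise), where the first factor is already of
    order q^2. *)
Lemma err_im_sym_bound :
  `|err_im mu rho kappa k h x + err_im mu rho kappa k h (- x)|
    <= 2 * (20 * (B ^+ 8 * (q ^+ 2 * delta))).
Proof.
have [d1 d2 d3] := damping_bound.
pose r := damping rho kappa k.
have -> : err_im mu rho kappa k h x + err_im mu rho kappa k h (- x) = 2 *
    ((kappa - sin_symbol kappa h) * (mu * k) + ((sin drift - drift)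
    + (- ((1 - r) * sin drift) + - (r * (sin drift * (1 - cos noise)))))).
  by rewrite /err_im /step_im -/r phaseN phaseE sinD sinB /drift; ring.
have nk : `|k| <= q ^+ 2 by rewrite kE ger0_norm ?sqr_ge0.
have sd : `|sin drift| <= B ^+ 2 * q ^+ 2.
  exact: le_trans (norm_sin_le _) drift_bound.
apply: norm_mul_le; first by rewrite ger0_norm.
refine (le_trans _ _).
  apply: norm_add_le.
    exact: norm_mul_le sin_symbol_near (norm_mul_le muB nk).
  apply: norm_add_le.
    exact: sinBid_le drift_bound.
  apply: norm_add_le.
    by rewrite normrN; apply: norm_mul_le d1 sd.
  rewrite normrN; apply: norm_mul_le d3 _; apply: norm_mul_le sd _.
  exact: onem_cos_le noise_bound.
have m0 := monomial_ge0 8 2.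
have m1 := @monomial_h 4 2 8 2 isT isT.
have m2 := @monomial_k 6 6 8 2 isT isT.
have m3 := @monomial_k 4 4 8 2 isT isT.
have m4 := @monomial_k 6 4 8 2 isT isT.
lra.
Qed.

End step_estimates.

(** * Expectations of products of independent factors *)

Section weighted_transfer.
Local Open Scope ereal_scope.
Context d1 d2 (X : measurableType d1) (Y : measurableType d2) (R : realType).
Variables (mu : {measure set X -> \bar R}) (nu : {measure set Y -> \bar R}).
Variables (phi : X -> Y) (mphi : measurable_fun setT phi).
Variables (W : X -> R) (mW : measurable_fun setT W) (W0 : forall x, (0 <= W x)%R).
Variables (c : R) (c0 : (0 <= c)%R).
Hypothesis muW : forall A, measurable A ->
  \int[mu]_x (W x * \1_A (phi x))%:E = c%:E * nu A.

Import HBNNSimple.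

Let weighted_transfer_nnsfun (g : {nnsfun Y >-> R}) :
  \int[mu]_x (W x * g (phi x))%:E = \int[nu]_y (c * g y)%:E.
Proof.
have mpre k : measurable (g @^-1` [set k]).
  by rewrite -[_ @^-1` _]setTI; exact: measurable_funP.
have mind k : measurable_fun setT (fun x => \1_(g @^-1` [set k]) (phi x) : R).
  by apply: measurableT_comp mphi; exact: measurable_indic.
have gterm0 k y : (0 <= k * \1_(g @^-1` [set k]) y)%R.
  have := nnfun_muleindic_ge0 g k y; rewrite lee_fin; exact.
transitivity (\int[mu]_x \sum_(k \in range g)
    (W x * (k * \1_(g @^-1` [set k]) (phi x)))%:E).
  apply: eq_integral => x _; rewrite fsumEFin//.
  rewrite [g _]fimfunE fsbig_finite// [in RHS]fsbig_finite//=.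
  by rewrite mulr_sumr.
transitivity (\int[nu]_y \sum_(k \in range g)
    (c * (k * \1_(g @^-1` [set k]) y))%:E); last first.
  apply: eq_integral => x _; rewrite fsumEFin//.
  rewrite [in RHS]fimfunE fsbig_finite// [in RHS]fsbig_finite//=.
  by rewrite mulr_sumr.
rewrite !ge0_integral_fsum//; last 4 first.
- move=> k; apply/measurable_EFinP; apply: measurable_funM => //.
  exact: measurable_funM.
- by move=> k y _; rewrite lee_fin mulr_ge0.
- move=> k; apply/measurable_EFinP; apply: measurable_funM => //.
  exact: measurable_funM.
- by move=> k x _; rewrite lee_fin mulr_ge0.
apply: eq_fsbigr => k _.
(* A negative k has empty preimage under g >= 0, and both integrals vanish. Otherwise k >= 0 can be
   taken out of them. *)
have [k0|k0] := ltP k 0%R.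
  have E y : \1_(g @^-1` [set k]) y = 0%R :> R.
    by rewrite preimage_nnfun0// indic0.
  by rewrite !integral0_eq// => x _; rewrite E !mulr0.
under eq_integral do rewrite mulrCA EFinM.
under [RHS]eq_integral do rewrite mulrCA EFinM.
rewrite !ge0_integralZl_EFin//; last 4 first.
- by move=> y _; rewrite lee_fin mulr_ge0.
- by apply/measurable_EFinP; apply: measurable_funM.
- by move=> x _; rewrite lee_fin mulr_ge0.
- by apply/measurable_EFinP; apply: measurable_funM.
rewrite muW//; under [in RHS]eq_integral do rewrite EFinM.
rewrite ge0_integralZl_EFin//; first by rewrite integral_indic// setIT.
exact/measurable_EFinP.
Qed.

(** This serves twice: with [phi] the identity and W the Gaussian density it gives integration
    against the normal law; with [phi] = X n and W a past factor times a cylinder indicator it gives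
    factorisation by independence. *)
Lemma weighted_transfer (f : Y -> R) : measurable_fun setT f ->
  (forall y, (0 <= f y)%R) ->
  \int[mu]_x (W x * f (phi x))%:E = c%:E * \int[nu]_y (f y)%:E.
Proof.
move=> mf f0.
have mf' : measurable_fun [set: Y] (EFin \o f) by exact/measurable_EFinP.
pose f_ := nnsfun_approx measurableT mf'.
have f_cvg y : (f_ n y)%:E @[n --> \oo] --> (f y)%:E.
  by apply: (cvg_nnsfun_approx measurableT mf') => // z _; rewrite lee_fin.
rewrite -ge0_integralZl_EFin//; last by move=> y _; rewrite lee_fin.
transitivity (limn (fun n => \int[mu]_x (W x * f_ n (phi x))%:E)).
  rewrite -monotone_convergence//.
  - apply: eq_integral => x _; apply/esym/cvg_lim => //.
    under eq_fun do rewrite EFinM.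
    by rewrite EFinM; apply: cvgeZl.
  - move=> n; apply/measurable_EFinP; apply: measurable_funM => //.
    exact: measurableT_comp.
  - by move=> n x _; rewrite lee_fin mulr_ge0.
  - move=> x _ m n mn; rewrite lee_fin ler_wpM2l//.
    exact/lefP/nd_nnsfun_approx.
under eq_fun do rewrite weighted_transfer_nnsfun.
rewrite -monotone_convergence//.
- apply: eq_integral => x _; apply/cvg_lim => //.
  under eq_fun do rewrite EFinM.
  by apply: cvgeZl.
- by move=> n; apply/measurable_EFinP; apply: measurable_funM.
- by move=> n x _; rewrite lee_fin mulr_ge0.
- move=> x _ m n mn; rewrite lee_fin ler_wpM2l//.
  exact/lefP/nd_nnsfun_approx.
Qed.

End weighted_transfer.

Lemma Rintegral_probability_cst d (T : measurableType d) (R : realType)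
    (P : probability T R) (r : R) : \int[P]_x cst r x = r.
Proof.
transitivity (r * fine (P setT)); last by rewrite probability_setT mulr1.
exact: Rintegral_cst.
Qed.

Lemma maxr0_subN (R : realDomainType) (r : R) :
  r = Num.max r 0 - Num.max (- r) 0.
Proof.
have [r0|/ltW r0] := lerP 0 r; first by rewrite (max_r (x := - r)) ?oppr_le0// subr0.
by rewrite (max_l (x := - r)) ?oppr_ge0// sub0r opprK.
Qed.

Section independent_factors.
Context d (Omega : measurableType d) (R : realType) (P : probability Omega R).
Variables (nu : {measure set (measurableTypeR R) -> \bar R}) (X : nat -> Omega -> R).
Hypothesis mX : forall n, measurable_fun setT (X n).
Hypothesis indepX : mutually_independent P X.
Hypothesis lawX : forall n A, measurable A -> P (X n @^-1` A) = nu A.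

Definition cylinder (J : {fset nat}) (A : nat -> set R) : set Omega :=
  \bigcap_(i in [set` J]) (X i @^-1` A i).

Lemma measurable_cylinder J A : (forall i, measurable (A i)) ->
  measurable (cylinder J A).
Proof.
move=> mA; apply: fin_bigcap_measurable => [|i _]; first exact: finite_fset.
by rewrite -[_ @^-1` _]setTI; exact: mX.
Qed.

(* A nonnegative surrogate for independence of F from X n, X n.+1, and so on,
   stable under multiplication by a function of X n. *)
Definition ge0_uncorrelated_from (n : nat) (F : Omega -> R) : Prop :=
  [/\ forall w, 0 <= F w, P.-integrable setT (EFin \o F) &
    forall J A, (forall i, measurable (A i)) ->
      (forall i, i \in J -> (n <= i)%N) ->
      (\int[P]_w (F w * \1_(cylinder J A) w)%:E
       = \int[P]_w (F w)%:E * P (cylinder J A))%E].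

(** Differences are needed because [weighted_transfer] is confined to nonnegative integrands,
    whereas real and imaginary parts of the multipliers change sign. *)
Definition uncorrelated_from (n : nat) (F : Omega -> R) : Prop :=
  exists F1 F2, [/\ ge0_uncorrelated_from n F1, ge0_uncorrelated_from n F2 &
    forall w, F w = F1 w - F2 w].

Lemma ge0_uncorrelated_from_cst (n : nat) (r : R) : 0 <= r ->
  ge0_uncorrelated_from n (cst r).
Proof.
move=> r0; split => // [|J A mA _].
  exact: finite_measure_integrable_cst.
have -> : (\int[P]_w (cst r w)%:E = r%:E)%E.
  transitivity (r%:E * P setT)%E; last by rewrite probability_setT mule1.
  exact: (@integral_cst _ _ _ P setT measurableT r%:E).
under eq_integral do rewrite EFinM.
rewrite ge0_integralZl_EFin//=.
- by rewrite integral_indic ?setIT//; exact: measurable_cylinder.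
- exact/measurable_EFinP/measurable_indic/measurable_cylinder.
Qed.

Lemma ge0_uncorrelated_fromD n F G :
  ge0_uncorrelated_from n F -> ge0_uncorrelated_from n G ->
  ge0_uncorrelated_from n (fun w => F w + G w).
Proof.
move=> [F0 iF fF] [G0 iG fG]; split => [w||J A mA nJ].
- exact: addr_ge0.
- exact: eq_integrable (integrableD measurableT iF iG).
have /measurable_EFinP mF := measurable_int _ iF.
have /measurable_EFinP mG := measurable_int _ iG.
have m1 : measurable_fun setT (\1_(cylinder J A) : Omega -> R).
  exact/measurable_indic/measurable_cylinder.
under eq_integral do rewrite mulrDl EFinD.
rewrite ge0_integralD//=; last 4 first.
- by move=> w _; rewrite lee_fin mulr_ge0.
- exact/measurable_EFinP/measurable_funM.
- by move=> w _; rewrite lee_fin mulr_ge0.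
- exact/measurable_EFinP/measurable_funM.
under [in RHS]eq_integral do rewrite EFinD.
rewrite ge0_integralD//=; last 4 first.
- by move=> w _; rewrite lee_fin.
- exact/measurable_EFinP.
- by move=> w _; rewrite lee_fin.
- exact/measurable_EFinP.
rewrite fF// fG//.
have a0 : (0 <= \int[P]_w (F w)%:E)%E.
  by apply: integral_ge0 => w _; rewrite lee_fin.
have b0 : (0 <= \int[P]_w (G w)%:E)%E.
  by apply: integral_ge0 => w _; rewrite lee_fin.
by move: (integral _ _ _) (integral _ _ _) a0 b0 => a b a0 b0; rewrite ge0_muleDl.
Qed.

(** If all indices of J exceed n, a condition on X n intersected with a J-cylinder is a cylinder
    from n on. Hence under the weight F times the indicator of the J-cylinder, X n still has law nu
    up to a constant factor, and f can be integrated against it. *)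
Lemma ge0_uncorrelated_fromM n F (f : R -> R) :
  ge0_uncorrelated_from n F -> (forall x, 0 <= f x) ->
  nu.-integrable setT (EFin \o f) ->
  ge0_uncorrelated_from n.+1 (fun w => F w * f (X n w)) /\
  \int[P]_w (F w * f (X n w)) = \int[P]_w F w * \int[nu]_x f x.
Proof.
move=> [F0 iF fF] f0 if_.
have /measurable_EFinP mF := measurable_int _ iF.
have /measurable_EFinP mf := measurable_int _ if_.
have EF : (\int[P]_w (F w)%:E = (\int[P]_w F w)%:E)%E.
  by rewrite /Rintegral fineK//; exact: integrable_fin_num iF.
have Ef : (\int[nu]_w (f w)%:E = (\int[nu]_w f w)%:E)%E.
  by rewrite /Rintegral fineK//; exact: integrable_fin_num if_.
have key J A : (forall i, measurable (A i)) ->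
    (forall i, i \in J -> (n.+1 <= i)%N) ->
    (\int[P]_w (F w * \1_(cylinder J A) w * f (X n w))%:E
     = \int[P]_w (F w)%:E * P (cylinder J A) * \int[nu]_x (f x)%:E)%E.
  move=> mA nJ; have mC := measurable_cylinder J mA.
  have nnJ : n \notin J by apply/negP => /nJ; rewrite ltnn.
  have PC : P (cylinder J A) = (fine (P (cylinder J A)))%:E.
    by rewrite fineK// fin_num_measure.
  rewrite EF PC -EFinM.
  apply: (@weighted_transfer _ _ _ (measurableTypeR R) _ P nu (X n) (mX n)
    (fun w => F w * \1_(cylinder J A) w)) => //.
  - by apply: measurable_funM => //; exact: measurable_indic.
  - by move=> w; rewrite mulr_ge0.
  - by apply: mulr_ge0; [exact: Rintegral_ge0|exact: fine_ge0].
  move=> A' mA'; rewrite EFinM -PC -EF -muleA.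
  (* The J-cylinder is extended by the condition A' on coordinate n; as n is not in J, the
     conditions on J are unchanged. *)
  pose A2 i := if i == n then A' else A i.
  have mA2 i : measurable (A2 i) by rewrite /A2; case: ifP => _; [exact: mA'|exact: mA].
  have CE : cylinder (n |` J)%fset A2 = cylinder J A `&` X n @^-1` A'.
    apply/seteqP; split => w.
      move=> h; split => [i /= iJ|].
        have := h i; rewrite /= !inE iJ orbT => /(_ isT); rewrite /A2.
        by case: eqP => // ein; rewrite ein (negbTE nnJ) in iJ.
      by have := h n; rewrite /= !inE eqxx => /(_ isT); rewrite /A2 eqxx.
    move=> [h1 h2] i /=; rewrite !inE /A2; case: eqP => [->//|_ /= iJ].
    exact: h1.
  have PE : (P (cylinder (n |` J)%fset A2) = P (cylinder J A) * nu A')%E.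
    rewrite /cylinder !indepX// big_fsetU1//= {1}/A2 eqxx lawX// muleC.
    congr (_ * _)%E; apply: eq_big_seq => i iJ; rewrite /A2.
    by case: eqP => // ein; rewrite ein (negbTE nnJ) in iJ.
  rewrite -PE -fF//.
    apply: eq_integral => w _; rewrite CE indicI/= mulrA.
    by congr (_ * _)%:E; rewrite !indicE.
  by move=> i; rewrite !inE => /predU1P[->//|/nJ]; exact: ltnW.
(* The cylinder over no index turns [key] into the plain product formula. *)
have cyl0 : cylinder fset0 (fun=> setT) = setT.
  by apply/seteqP; split => // w _ i.
have key0 : (\int[P]_w (F w * f (X n w))%:E
    = \int[P]_w (F w)%:E * \int[nu]_x (f x)%:E)%E.
  have := key fset0 (fun=> setT) (fun=> measurableT).
  rewrite cyl0 probability_setT mule1 => <-//.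
  by apply: eq_integral => w _; rewrite indicT mulr1.
have mFf : measurable_fun setT (fun w => F w * f (X n w)).
  by apply: measurable_funM => //; exact: measurableT_comp.
split; last by rewrite {1}/Rintegral key0 EF Ef.
split => [w||J A mA nJ].
- exact: mulr_ge0.
- apply/integrableP; split; first exact/measurable_EFinP.
  under eq_integral do rewrite /= ger0_norm ?mulr_ge0//.
  by rewrite key0 EF Ef ltry.
- under eq_integral do rewrite mulrAC.
  by rewrite key// key0 muleAC.
Qed.

Lemma uncorrelated_from_integrable n F : uncorrelated_from n F ->
  P.-integrable setT (EFin \o F).
Proof.
move=> [F1 [F2 [[_ i1 _] [_ i2 _] FE]]].
apply: eq_integrable (integrableB measurableT i1 i2) => //.
by move=> w _; rewrite /= FE EFinB.
Qed.

Lemma uncorrelated_from_cst n (r : R) : uncorrelated_from n (cst r).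
Proof.
exists (cst (Num.max r 0)), (cst (Num.max (- r) 0)); split.
- by apply: ge0_uncorrelated_from_cst; rewrite le_max lexx orbT.
- by apply: ge0_uncorrelated_from_cst; rewrite le_max lexx orbT.
- by move=> w; exact: maxr0_subN.
Qed.

Lemma uncorrelated_fromD n F G :
  uncorrelated_from n F -> uncorrelated_from n G ->
  uncorrelated_from n (fun w => F w + G w).
Proof.
move=> [F1 [F2 [f1 f2 FE]]] [G1 [G2 [g1 g2 GE]]].
exists (fun w => F1 w + G1 w), (fun w => F2 w + G2 w); split.
- exact: ge0_uncorrelated_fromD.
- exact: ge0_uncorrelated_fromD.
- by move=> w; rewrite FE GE; ring.
Qed.

Lemma uncorrelated_fromN n F : uncorrelated_from n F ->
  uncorrelated_from n (fun w => - F w).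
Proof.
move=> [F1 [F2 [f1 f2 FE]]]; exists F2, F1; split => // w.
by rewrite FE opprB.
Qed.

Lemma uncorrelated_fromM n F (f : R -> R) :
  uncorrelated_from n F -> nu.-integrable setT (EFin \o f) ->
  uncorrelated_from n.+1 (fun w => F w * f (X n w)) /\
  \int[P]_w (F w * f (X n w)) = \int[P]_w F w * \int[nu]_x f x.
Proof.
move=> [F1 [F2 [f1 f2 FE]]] fi.
pose fp x := Num.max (f x) 0; pose fn x := Num.max (- f x) 0.
have fE x : f x = fp x - fn x.
  exact: maxr0_subN.
have fp0 x : 0 <= fp x by rewrite le_max lexx orbT.
have fn0 x : 0 <= fn x by rewrite le_max lexx orbT.
have /measurable_EFinP mf := measurable_int _ fi.
have ip : nu.-integrable setT (EFin \o fp).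
  apply: le_integrable fi => //.
    by apply/measurable_EFinP; apply: measurable_maxr.
  move=> x _ /=; rewrite lee_fin ger0_norm// /fp ge_max normr_ge0 andbT.
  exact: ler_norm.
have in_ : nu.-integrable setT (EFin \o fn).
  apply: le_integrable fi => //.
    apply/measurable_EFinP; apply: measurable_maxr => //.
    exact: measurableT_comp.
  move=> x _ /=; rewrite lee_fin ger0_norm// /fn ge_max normr_ge0 andbT.
  by rewrite -normrN ler_norm.
have [p1 e1] := ge0_uncorrelated_fromM f1 fp0 ip.
have [p2 e2] := ge0_uncorrelated_fromM f2 fp0 ip.
have [n1 e3] := ge0_uncorrelated_fromM f1 fn0 in_.
have [n2 e4] := ge0_uncorrelated_fromM f2 fn0 in_.
have [[_ i1 _] [_ i2 _]] := (f1, f2).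
have [_ ip1 _] := p1; have [_ ip2 _] := p2.
have [_ in1 _] := n1; have [_ in2 _] := n2.
have FfE w : F w * f (X n w) =
   (F1 w * fp (X n w) + F2 w * fn (X n w)) -
   (F2 w * fp (X n w) + F1 w * fn (X n w)).
  by rewrite FE fE; ring.
split.
  exists (fun w => F1 w * fp (X n w) + F2 w * fn (X n w)),
    (fun w => F2 w * fp (X n w) + F1 w * fn (X n w)); split => //.
  - exact: ge0_uncorrelated_fromD.
  - exact: ge0_uncorrelated_fromD.
under eq_Rintegral do rewrite FfE.
rewrite RintegralB//; last 2 first.
- exact: eq_integrable (integrableD measurableT ip1 in2).
- exact: eq_integrable (integrableD measurableT ip2 in1).
rewrite !RintegralD// e1 e2 e3 e4.
under [in RHS]eq_Rintegral do rewrite FE.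
under [X in _ = _ * X]eq_Rintegral do rewrite fE.
by rewrite !RintegralB//; ring.
Qed.

Lemma expectation_complex_prod (f g : R -> R) (n : nat) :
  nu.-integrable setT (EFin \o f) -> nu.-integrable setT (EFin \o g) ->
  let Q n w := \prod_(j < n) (f (X j w) +i* g (X j w)) : R[i] in
  [/\ P.-integrable setT (fun w => (complex.Re (Q n w))%:E),
      P.-integrable setT (fun w => (complex.Im (Q n w))%:E) &
      \int[P]_w complex.Re (Q n w) +i* \int[P]_w complex.Im (Q n w)
      = (\int[nu]_x f x +i* \int[nu]_x g x) ^+ n].
Proof.
move=> fi gi Q.
(* Integrability alone would not carry the induction: the next factor can only be split off if both
   parts of the partial product are uncorrelated with the increments from n on. *)
suff [u v e] : [/\ uncorrelated_from n (fun w => complex.Re (Q n w)),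
    uncorrelated_from n (fun w => complex.Im (Q n w)) &
    \int[P]_w complex.Re (Q n w) +i* \int[P]_w complex.Im (Q n w)
      = (\int[nu]_x f x +i* \int[nu]_x g x) ^+ n].
  by split; [exact: uncorrelated_from_integrable u
            |exact: uncorrelated_from_integrable v|].
elim: n => [|n [u v e]].
  have Re0 : (fun w => complex.Re (Q 0%N w)) = cst 1.
    by apply/funext => w; rewrite /Q big_ord0.
  have Im0 : (fun w => complex.Im (Q 0%N w)) = cst 0.
    by apply/funext => w; rewrite /Q big_ord0.
  rewrite Re0 Im0.
  split; [exact: uncorrelated_from_cst|exact: uncorrelated_from_cst|].
  by rewrite expr0 !Rintegral_probability_cst.
have ReS : (fun w => complex.Re (Q n.+1 w)) = (fun w =>
    complex.Re (Q n w) * f (X n w) - complex.Im (Q n w) * g (X n w)).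
  by apply/funext => w; rewrite /Q big_ord_recr/=; case: (\prod_(_ < _) _).
have ImS : (fun w => complex.Im (Q n.+1 w)) = (fun w =>
    complex.Re (Q n w) * g (X n w) + complex.Im (Q n w) * f (X n w)).
  by apply/funext => w; rewrite /Q big_ord_recr/=; case: (\prod_(_ < _) _).
rewrite ReS ImS.
have [u1 e1] := uncorrelated_fromM u fi.
have [u2 e2] := uncorrelated_fromM u gi.
have [v1 e3] := uncorrelated_fromM v fi.
have [v2 e4] := uncorrelated_fromM v gi.
split.
- by apply: uncorrelated_fromD => //; exact: uncorrelated_fromN.
- exact: uncorrelated_fromD.
have i1 := uncorrelated_from_integrable u1.
have i2 := uncorrelated_from_integrable u2.
have i3 := uncorrelated_from_integrable v1.
have i4 := uncorrelated_from_integrable v2.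
by rewrite RintegralB ?RintegralD// e1 e2 e3 e4 exprSr -e.
Qed.

End independent_factors.

(** * Gaussian moments *)

Section gaussian.
Context (R : realType).
Variables (q : R) (q_gt0 : 0 < q).
Notation lambda := (@lebesgue_measure R).
Notation nu := (normal_prob 0 q).
Notation pdf := (normal_pdf 0 q).

Let q_neq0 : q != 0. Proof. by rewrite gt_eqF. Qed.

Lemma normal_pdf0N (x : R) : pdf (- x) = pdf x.
Proof. by rewrite !normal_pdfE// /normal_fun !subr0 sqrrN. Qed.

Let integral_pdf_indic A : measurable A ->
  (\int[lambda]_x (pdf x * \1_A x)%:E = nu A)%E.
Proof.
move=> mA; rewrite /normal_prob [RHS]integral_mkcond/=.
apply: eq_integral => x _; rewrite patchE indicE.
by case: (x \in A); rewrite ?mulr1 ?mulr0.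
Qed.

Lemma integral_lebesgueN (f : R -> R) : measurable_fun setT f ->
  (forall x, 0 <= f x) ->
  (\int[lambda]_x (f (- x))%:E = \int[lambda]_x (f x)%:E)%E.
Proof.
move=> mf f0.
have mN : measurable_fun setT (-%R : R -> measurableTypeR R).
  exact: oppr_measurable.
rewrite [RHS](eq_measure_integral (pushforward lambda
  (-%R : R -> measurableTypeR R))); last first.
  by move=> A mA _; exact/esym/lebesgue_measureN.
rewrite ge0_integral_pushforward//; first exact/measurable_EFinP.
by move=> x _; rewrite lee_fin.
Qed.

Lemma normal_prob0N (A : set R) : measurable A ->
  nu (-%R @^-1` A) = nu A.
Proof.
move=> mA; have mNA : measurable (-%R @^-1` A).
  by rewrite -[_ @^-1` _]setTI; exact: oppr_measurable.
rewrite -!integral_pdf_indic// -[RHS]integral_lebesgueN.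
- by apply: eq_integral => x _; rewrite normal_pdf0N.
- apply: measurable_funM; first exact: measurable_normal_pdf.
  exact: measurable_indic.
- by move=> x; rewrite mulr_ge0 ?normal_pdf_ge0.
Qed.

Lemma ge0_integral_normal_prob (f : R -> R) : measurable_fun setT f ->
  (forall x, 0 <= f x) ->
  (\int[nu]_x (f x)%:E = \int[lambda]_x (pdf x * f x)%:E)%E.
Proof.
move=> mf f0; rewrite -[LHS]mul1e; apply/esym.
apply: (@weighted_transfer _ _ _ _ _ lambda nu id) => //.
- exact: measurable_normal_pdf.
- by move=> x; exact: normal_pdf_ge0.
- by move=> A mA; rewrite mul1e integral_pdf_indic.
Qed.

(* Multiplying the density of N(0, q^2) by this weight gives a multiple of the
   density of N(0, 2 q^2); it stands in for all polynomial moments. *)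
Definition gauss_weight (x : R) : R := expR (x ^+ 2 / (4 * q ^+ 2)).

Lemma measurable_gauss_weight : measurable_fun setT gauss_weight.
Proof.
by apply: measurableT_comp => //; apply: measurable_funM.
Qed.

(** The value is the ratio of the standard deviations of the two Gaussians. It does not depend on q,
    which makes all later constants uniform in the timestep. *)
Lemma integral_gauss_weight :
  (\int[nu]_x (gauss_weight x)%:E = (Num.sqrt 2)%:E)%E.
Proof.
have s2 : 0 < Num.sqrt 2 :> R by rewrite sqrtr_gt0.
rewrite ge0_integral_normal_prob//; [|exact: measurable_gauss_weight|].
  2: by move=> x; exact: expR_ge0.
have sq0 : Num.sqrt 2 * q != 0 by rewrite mulf_neq0// gt_eqF.
transitivity (\int[lambda]_x ((Num.sqrt 2)%:E *
    (normal_pdf 0 (Num.sqrt 2 * q) x)%:E))%E; last first.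
  rewrite ge0_integralZl_EFin ?integral_normal_pdf ?mule1 ?ltW//.
    by move=> x _; rewrite lee_fin normal_pdf_ge0.
  by apply/measurable_EFinP; exact: measurable_normal_pdf.
apply: eq_integral => x _; rewrite -EFinM; congr EFin.
rewrite !normal_pdfE// /normal_fun /gauss_weight -mulrA -expRD !subr0.
rewrite [RHS]mulrA; congr (_ * expR _).
  rewrite /normal_peak exprMn sqr_sqrtr//.
  have -> : 2 * q ^+ 2 * pi *+ 2 = 2 * (q ^+ 2 * pi *+ 2) by ring.
  by rewrite sqrtrM// invfM mulVKf// gt_eqF.
by rewrite exprMn sqr_sqrtr//; field.
Qed.

Lemma integrable_dominated_gauss_weight (f : R -> R) (K : R) :
  measurable_fun setT f -> (forall x, `|f x| <= K * gauss_weight x) ->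
  nu.-integrable setT (EFin \o f).
Proof.
move=> mf fK.
have mw := measurable_gauss_weight.
have iw : nu.-integrable setT (EFin \o gauss_weight).
  apply/integrableP; split; first exact/measurable_EFinP.
  under eq_integral do rewrite /= ger0_norm ?expR_ge0//.
  by rewrite integral_gauss_weight ltry.
have iKw : nu.-integrable setT (EFin \o (fun x => K * gauss_weight x)).
  by apply: eq_integrable (integrableZl measurableT K iw).
apply: le_integrable iKw => //; first exact/measurable_EFinP.
move=> x _ /=; rewrite lee_fin (le_trans (fK x))//.
exact: ler_norm.
Qed.

Lemma Rintegral_normal_prob0N (f : R -> R) :
  nu.-integrable setT (EFin \o f) ->
  nu.-integrable setT (EFin \o (fun x => f (- x))) /\
  \int[nu]_x f (- x) = \int[nu]_x f x.
Proof.
move=> fi; have /measurable_EFinP mf := measurable_int _ fi.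
have mN : measurable_fun setT (-%R : R -> measurableTypeR R).
  exact: oppr_measurable.
have fiN : nu.-integrable setT (EFin \o (fun x => f (- x))).
  move/integrableP: fi => [_ fi]; apply/integrableP; split.
    by apply/measurable_EFinP; exact: measurableT_comp mN.
  apply: le_lt_trans fi.
  rewrite [leRHS](eq_measure_integral (pushforward nu
    (-%R : R -> measurableTypeR R))); last first.
    by move=> A mA _; exact/esym/normal_prob0N.
  rewrite ge0_integral_pushforward//.
  by do 2 apply: measurableT_comp => //; exact/measurable_EFinP.
split => //; rewrite /Rintegral; congr fine.
rewrite [RHS](eq_measure_integral (pushforward nu
  (-%R : R -> measurableTypeR R))); last first.
  by move=> A mA _; exact/esym/normal_prob0N.
by rewrite integral_pushforward//; exact/measurable_EFinP.
Qed.

Lemma Rintegral_gauss_weight : \int[nu]_x gauss_weight x = Num.sqrt 2.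
Proof. by rewrite /Rintegral integral_gauss_weight. Qed.

(** By symmetry of the law the integral of f is half that of f(x) + f(-x). The bound K secures
    integrability, and the size of the result comes from K' alone. *)
Lemma norm_Rintegral_gauss_sym_le (f : R -> R) (K K' : R) :
  measurable_fun setT f -> (forall x, `|f x| <= K * gauss_weight x) ->
  (forall x, `|f x + f (- x)| <= 2 * (K' * gauss_weight x)) ->
  `|\int[nu]_x f x| <= 2 * K'.
Proof.
move=> mf fK fK'.
have fi := integrable_dominated_gauss_weight mf fK.
have [fiN fE] := Rintegral_normal_prob0N fi.
have K'0 : 0 <= K'.
  have := le_trans (normr_ge0 _) (fK' 0).
  by rewrite pmulr_rge0// pmulr_lge0// expR_gt0.
have e : \int[nu]_x f x = 2^-1 * \int[nu]_x (f x + f (- x)).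
  by rewrite RintegralD// fE; field.
rewrite e normrM [ `|2^-1|]ger0_norm// ler_pdivrMl//.
have fi2 : nu.-integrable setT (EFin \o (fun x => f x + f (- x))).
  exact: eq_integrable (integrableD measurableT fi fiN).
apply: le_trans (le_normr_Rintegral measurableT fi2) _.
have mw := measurable_gauss_weight.
have iw : nu.-integrable setT (EFin \o (fun x => 2 * (K' * gauss_weight x))).
  apply: (@integrable_dominated_gauss_weight _ (2 * K')) => [|x].
    by do 2 apply: measurable_funM => //.
  by rewrite mulrA ger0_norm// !mulr_ge0 ?expR_ge0.
apply: (@le_trans _ _ (\int[nu]_x (2 * (K' * gauss_weight x)))).
  by apply: le_Rintegral => //; exact: integrable_norm fi2.
under eq_Rintegral do rewrite mulrA.
rewrite RintegralZl//; last first.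
  apply: (@integrable_dominated_gauss_weight _ 1) => // x.
  by rewrite mul1r ger0_norm ?expR_ge0.
rewrite Rintegral_gauss_weight -mulrA ler_pM2l// mulrC ler_wpM2r//.
(* The mean sqrt 2 of the weight is rounded up to 2. *)
by rewrite -[leRHS](@ger0_norm R 2)// -sqrtr_sqr ler_sqrt// -natrX ler_nat.
Qed.

End gaussian.

(** * Recursion for the mean-square error *)

Lemma normc_sqr (R : rcfType) (z : R[i]) :
  normc z ^+ 2 = complex.Re z ^+ 2 + complex.Im z ^+ 2.
Proof. by case: z => x y /=; rewrite sqr_sqrtr ?addr_ge0 ?sqr_ge0. Qed.

Lemma normc_ge0 (R : rcfType) (z : R[i]) : 0 <= normc z.
Proof. by case: z => x y /=; rewrite sqrtr_ge0. Qed.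

Lemma norm_Re_le_normc (R : rcfType) (z : R[i]) : `|complex.Re z| <= normc z.
Proof.
rewrite -(@ler_pXn2r _ 2) ?nnegrE ?normc_ge0// normc_sqr real_normK ?num_real//.
by rewrite lerDl sqr_ge0.
Qed.

Lemma normc_le_ReIm (R : rcfType) (z : R[i]) :
  normc z <= `|complex.Re z| + `|complex.Im z|.
Proof.
rewrite -(@ler_pXn2r _ 2) ?nnegrE ?normc_ge0 ?addr_ge0// normc_sqr sqrrD.
by rewrite !real_normK ?num_real// addrAC lerDl mulrn_wge0.
Qed.

Lemma normc_real (R : rcfType) (x : R) : normc x%:C = `|x|.
Proof. by rewrite /= expr0n/= addr0 sqrtr_sqr. Qed.

Lemma normc_exp (R : rcfType) (z : R[i]) n : normc (z ^+ n) = normc z ^+ n.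
Proof.
by elim: n => [|n IH]; rewrite ?expr0 ?normc1// !exprS normcM IH.
Qed.

Lemma normc_add_le (R : rcfType) (z w : R[i]) (x y : R) :
  normc z <= x -> normc w <= y -> normc (z + w) <= x + y.
Proof. by move=> ? ?; rewrite (le_trans (le_normcD _ _))// lerD. Qed.

Lemma normc_mul_le (R : rcfType) (z w : R[i]) (x y : R) :
  normc z <= x -> normc w <= y -> normc (z * w) <= x * y.
Proof. by move=> ? ?; rewrite normcM ler_pM ?normc_ge0. Qed.

(* [a], [b], [c] are the one-step moments E|A|^2, E[A conj(E)] and |E|^2. *)
Section error_recursion.
Variables (R : realType) (a c : R) (b : R[i]) (L k delta : R).
Hypotheses (L_ge0 : 0 <= L) (k_ge0 : 0 <= k).
Hypotheses (delta_ge0 : 0 <= delta) (delta_le2 : delta <= 2).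
Hypotheses (a_ge0 : 0 <= a) (c_ge0 : 0 <= c) (c_le1 : c <= 1).
Hypothesis second_diff : `|a - 2 * complex.Re b + c| <= L * k * delta ^+ 2.
Hypothesis first_diff : normc (b - c%:C) <= L * k * delta.

(** A common bound for a, |b| and c. With delta <= 2, a <= c + 2 L k delta + L k delta^2 <= 1 + 4 L
    k + 4 L k. *)
Let growth := 1 + 8 * (L * k).

Let Lk_ge0 : 0 <= L * k. Proof. exact: mulr_ge0. Qed.

Let growth_ge1 : 1 <= growth.
Proof. by rewrite lerDl mulr_ge0. Qed.

Let growth_ge0 : 0 <= growth. Proof. exact: le_trans growth_ge1. Qed.

Let delta_sqr_le : L * k * delta ^+ 2 <= 2 * (L * k * delta).
Proof.
rewrite expr2 mulrA [leRHS]mulrC ler_wpM2l//.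
exact: mulr_ge0.
Qed.

Let Lkd_le : L * k * delta <= 2 * (L * k).
Proof. by rewrite mulrC ler_wpM2r. Qed.

Let Re_b : `|complex.Re b - c| <= L * k * delta.
Proof.
have -> : complex.Re b - c = complex.Re (b - c%:C) by case: b.
exact: le_trans (norm_Re_le_normc _) first_diff.
Qed.

Let a_le : a <= growth.
Proof.
have := Re_b; have := second_diff; rewrite !ler_norml => /andP[_ h1] /andP[_ h2].
rewrite /growth; move: delta_sqr_le Lkd_le c_le1 => h3 h4 h5; lra.
Qed.

Let b_le : normc b <= growth.
Proof.
rewrite -[b](subrK c%:C).
apply: le_trans (normc_add_le first_diff (lexx _)) _.
rewrite normc_real ger0_norm// /growth.
move: Lkd_le c_le1 Lk_ge0 => h4 h5 h6; lra.
Qed.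

(** Since a - b = (a - 2 Re b + c) + conj(b - c), the two hypotheses give it, with L k delta^2 <= 2
    L k delta. *)
Let aB : normc (a%:C - b) <= 3 * (L * k * delta).
Proof.
have -> : a%:C - b = (a - 2 * complex.Re b + c)%:C + (b - c%:C)^*%C.
  by case: b => x y; apply/eqP; rewrite eq_complex /=; apply/andP; split;
    apply/eqP; ring.
have e : normc (b - c%:C)^*%C <= L * k * delta.
  by rewrite (_ : normc _ = normc (b - c%:C))//; case: b => x y /=; rewrite sqrrN.
have h : normc (a - 2 * complex.Re b + c)%:C <= L * k * delta ^+ 2.
  by rewrite normc_real.
apply: le_trans (normc_add_le h e) _; move: delta_sqr_le => h3; lra.
Qed.

Let bcX n : normc (b ^+ n - c%:C ^+ n) <= n%:R * (L * k * delta) * growth ^+ n.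
Proof.
have Lkd0 : 0 <= L * k * delta by exact: mulr_ge0.
elim: n => [|n IH]; first by rewrite !expr0 subrr normc0 !mul0r.
have -> : b ^+ n.+1 - c%:C ^+ n.+1 =
    b * (b ^+ n - c%:C ^+ n) + (b - c%:C) * c%:C ^+ n.
  by rewrite !exprS; ring.
have cX : normc (c%:C ^+ n) <= growth ^+ n.+1.
  rewrite normc_exp normc_real ger0_norm//.
  by apply: (@le_trans _ _ 1); [exact: exprn_ile1|exact: exprn_ege1].
apply: le_trans (normc_add_le (normc_mul_le b_le IH)
  (normc_mul_le first_diff cX)) _.
by rewrite exprS -natr1 le_eqVlt; apply/orP; left; apply/eqP; ring.
Qed.

Let err n : R := a ^+ n - 2 * complex.Re (b ^+ n) + c ^+ n.

(* Summing the square as a second difference keeps one factor delta in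
   [b ^+ n - c ^+ n] and another one in [a - b]. *)
Let errS n : err n.+1 = a * err n
  + 2 * complex.Re ((a%:C - b) * (b ^+ n - c%:C ^+ n))
  + (a - 2 * complex.Re b + c) * c ^+ n.
Proof.
rewrite /err !exprS -(rmorphXn (@real_complex R)) /=.
case: (b ^+ n) => u v; case: b => x y /=; ring.
Qed.

(** The source terms of [errS] are bounded uniformly in n <= N by a single K of order k delta^2. The
    sum over N steps is N K, multiplied by growth^N <= exp(8 L N k), so N and k enter through the
    product N k only. *)
Lemma error_recursion (N : nat) :
  a ^+ N - 2 * complex.Re (b ^+ N) + c ^+ N
  <= (N%:R * k) * delta ^+ 2
      * (L * (6 * (N%:R * k) * L * expR (8 * L * (N%:R * k)) + 1)
      * expR (8 * L * (N%:R * k))).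
Proof.
pose G := expR (8 * L * (N%:R * k)).
have gG : growth ^+ N <= G.
  rewrite /G (_ : 8 * L * (N%:R * k) = N%:R * (8 * (L * k))); last by ring.
  by rewrite expRM_natl lerXn2r ?nnegrE// ?expR_ge0// expR_ge1Dx.
have G0 : 0 <= G by exact: expR_ge0.
(* The 6 is twice the 3 of [aB]; the summand 1 is the second difference itself. *)
pose K := k * delta ^+ 2 * (L * (6 * (N%:R * k) * L * G + 1)).
have K0 : 0 <= K.
  by rewrite !mulr_ge0 ?sqr_ge0// addr_ge0// !mulr_ge0.
have main n : (n <= N)%N -> err n <= n%:R * K * growth ^+ n.
  elim: n => [_|n IH nN]; first by rewrite /err !expr0 mul0r /=; lra.
  rewrite errS.
  have h1 : a * err n <= n%:R * K * growth ^+ n.+1.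
    rewrite exprS mulrCA; apply: (@le_trans _ _ (a * (n%:R * K * growth ^+ n))).
      by rewrite ler_wpM2l// IH// ltnW.
    by apply: ler_wpM2r a_le; rewrite mulr_ge0 ?exprn_ge0// mulr_ge0.
  have h2 : 2 * complex.Re ((a%:C - b) * (b ^+ n - c%:C ^+ n))
      <= 6 * (L * k * delta) * ((N%:R * k) * L * delta * G).
    have h : normc ((a%:C - b) * (b ^+ n - c%:C ^+ n)) <=
        (3 * (L * k * delta)) * (N%:R * (L * k * delta) * G).
      apply: normc_mul_le aB _; apply: le_trans (bcX n) _.
      rewrite ler_pM ?mulr_ge0 ?exprn_ge0//.
        by rewrite ler_wpM2r ?mulr_ge0// ler_nat ltnW.
      by apply: le_trans gG; apply: ler_weXn2l => //; exact: ltnW.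
    have := le_trans (norm_Re_le_normc _) h.
    rewrite ler_norml => /andP[_]; move: (complex.Re _) => r hr.
    lra.
  have h3 : (a - 2 * complex.Re b + c) * c ^+ n <= L * k * delta ^+ 2.
    apply: le_trans (ler_norm _) _; rewrite normrM -[leRHS]mulr1.
    rewrite ler_pM//.
    by rewrite ger0_norm ?exprn_ge0// exprn_ile1.
  have h4 : K <= K * growth ^+ n.+1 by rewrite ler_peMr// exprn_ege1.
  have hK : 6 * (L * k * delta) * ((N%:R * k) * L * delta * G)
     + L * k * delta ^+ 2 = K by rewrite /K; ring.
  have -> : n.+1%:R = n%:R + 1 :> R by rewrite -natr1.
  lra.
have := main N (leqnn N); rewrite /err => /le_trans; apply.
apply: (@le_trans _ _ (N%:R * K * G)).
  by rewrite ler_wpM2l// mulr_ge0.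
by rewrite /K /G le_eqVlt; apply/orP; left; apply/eqP; ring.
Qed.

End error_recursion.

(** * One step of the scheme *)

(** With z = |x|/q and m = n + 1, the weight is the m-th power of exp(z^2/(4m)), so one factor
    suffices. There z <= m + z^2/(4m), by the square (z - 2m)^2, and 1 + y <= e^y. *)
Lemma pow_le_gauss_weight (R : realType) (q x : R) (n : nat) : 0 < q ->
  (1 + `|x| / q) ^+ n.+1 <= n.+2%:R ^+ n.+1 * gauss_weight q x.
Proof.
move=> q0; set z := `|x| / q; set m : R := n.+1%:R.
have m1 : 1 <= m by rewrite ler1n.
have m0 : 0 < m by exact: lt_le_trans m1.
have z0 : 0 <= z by rewrite divr_ge0 // ltW.
have wE : gauss_weight q x = expR (z ^+ 2 / (4 * m)) ^+ n.+1.
  rewrite -expRM_natl /gauss_weight; congr expR.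
  rewrite /z exprMn real_normK ?num_real// -/m; field.
  by rewrite !gt_eqF.
have mS : n.+2%:R = m + 1 :> R by rewrite /m -natr1.
clearbody z; rewrite wE -exprMn lerXn2r ?nnegrE ?addr_ge0 ?mulr_ge0 ?expR_ge0//.
have zm : z <= m + z ^+ 2 / (4 * m).
  rewrite -subr_ge0 (_ : _ - _ = (z - 2 * m) ^+ 2 / (4 * m)).
    by rewrite divr_ge0 ?sqr_ge0// mulr_ge0 // ltW.
  by field; rewrite gt_eqF.
have z2 : 0 <= z ^+ 2 / (4 * m) by rewrite divr_ge0 ?sqr_ge0// mulr_ge0// ltW.
apply: (@le_trans _ _ ((m + 1) * (1 + z ^+ 2 / (4 * m)))).
  move: (z ^+ 2 / (4 * m)) zm z2 => y zm z2; nra.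
by rewrite mS ler_wpM2l ?expR_ge1Dx// addr_ge0// ltW.
Qed.

(* Up to a factor 2, a bound on the (n.+1)-st moment of the size B below. *)
Definition moment_const (R : realType) (mu kappa : R) (n : nat) : R :=
  ((1 + `|kappa| + `|mu|) * n.+2%:R) ^+ n.+1.

Section one_step.
Variables (R : realType) (mu rho kappa q h : R).
Hypotheses (rho_ge0 : 0 <= rho) (rho_le1 : rho <= 1).
Hypotheses (q_gt0 : 0 < q) (q_le1 : q <= 1) (h_gt0 : 0 < h).

Let k := q ^+ 2.
Let delta := k + h ^+ 2.
Notation nu := (normal_prob 0 q).
Notation w := (gauss_weight q).

Let scale : R := 1 + `|kappa| + `|mu|.
(** The B of the pathwise estimates as a function of the increment: even in x, so that it survives
    symmetrisation, and a function of |x|/q, so that its moments are uniform in q. *)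
Let B (x : R) := scale * (1 + `|x| / q).

Let A1 := step_re rho kappa k h.
Let A2 := step_im mu rho kappa k h.
Let r := damping rho kappa k.
Let th := phase mu rho kappa k.
Let D1 := err_re mu rho kappa k h.
Let D2 := err_im mu rho kappa k h.

Let scale_ge1 : 1 <= scale.
Proof. by rewrite /scale -addrA lerDl addr_ge0. Qed.

Let rel_ge1 (x : R) : 1 <= 1 + `|x| / q.
Proof. by rewrite lerDl divr_ge0// ltW. Qed.

Let B_ge1 x : 1 <= B x.
Proof. by rewrite -[leLHS]mulr1 ler_pM. Qed.

Let scale_le_B x : scale <= B x.
Proof. by rewrite ler_peMr// (le_trans _ scale_ge1). Qed.

Let kappa_le x : `|kappa| <= B x.
Proof.
apply: le_trans (scale_le_B x); rewrite /scale.
have := normr_ge0 kappa; have := normr_ge0 mu; lra.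
Qed.

Let mu_le x : `|mu| <= B x.
Proof.
apply: le_trans (scale_le_B x); rewrite /scale.
have := normr_ge0 kappa; have := normr_ge0 mu; lra.
Qed.

Let x_le x : `|x| <= q * B x.
Proof.
rewrite /B mulrCA; apply: (@le_trans _ _ (q * (1 + `|x| / q))).
  by rewrite mulrDr mulr1 mulrCA divff ?gt_eqF// mulr1 lerDr ltW.
by rewrite ler_peMl// mulr_ge0 ?(ltW q_gt0)// (le_trans _ (rel_ge1 x)).
Qed.

Let B_pow n x : B x ^+ n.+1 <= moment_const mu kappa n * w x.
Proof.
rewrite /B /moment_const -/scale !exprMn -mulrA ler_wpM2l ?exprn_ge0//.
  by rewrite (le_trans _ scale_ge1).
exact: pow_le_gauss_weight.
Qed.

Let B_N x : B (- x) = B x. Proof. by rewrite /B normrN. Qed.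

Let B_mono x i j : (i <= j)%N -> B x ^+ i <= B x ^+ j.
Proof. by move=> ij; exact: ler_weXn2l. Qed.

Let delta_ge0 : 0 <= delta. Proof. by rewrite addr_ge0 ?sqr_ge0. Qed.

Let D1_le x : `|D1 x| <= 20 * (q * delta) * B x ^+ 8.
Proof.
have := @err_re_bound R mu rho kappa k h q x (B x) rho_ge0 rho_le1 (ltW q_gt0)
  q_le1 erefl h_gt0 (B_ge1 x) (kappa_le x) (mu_le x) (x_le x).
by rewrite expr1 -/delta => /le_trans; apply; rewrite -mulrA [B x ^+ 8 * _]mulrC.
Qed.

Let D2_le x : `|D2 x| <= 20 * (q * delta) * B x ^+ 8.
Proof.
have := @err_im_bound R mu rho kappa k h q x (B x) rho_ge0 rho_le1 (ltW q_gt0)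
  q_le1 erefl h_gt0 (B_ge1 x) (kappa_le x) (mu_le x) (x_le x).
by rewrite expr1 -/delta => /le_trans; apply; rewrite -mulrA [B x ^+ 8 * _]mulrC.
Qed.

Let D1_sym_le x : `|D1 x + D1 (- x)| <= 40 * (q ^+ 2 * delta) * B x ^+ 8.
Proof.
have := @err_re_sym_bound R mu rho kappa k h q x (B x) rho_ge0 rho_le1
  (ltW q_gt0) q_le1 erefl h_gt0 (B_ge1 x) (kappa_le x) (mu_le x) (x_le x).
by rewrite -/delta => /le_trans; apply; rewrite le_eqVlt; apply/orP; left;
  apply/eqP; ring.
Qed.

Let D2_sym_le x : `|D2 x + D2 (- x)| <= 40 * (q ^+ 2 * delta) * B x ^+ 8.
Proof.
have := @err_im_sym_bound R mu rho kappa k h q x (B x) rho_ge0 rho_le1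
  (ltW q_gt0) q_le1 erefl h_gt0 (B_ge1 x) (kappa_le x) (mu_le x) (x_le x).
by rewrite -/delta => /le_trans; apply; rewrite le_eqVlt; apply/orP; left;
  apply/eqP; ring.
Qed.

Let E1_le x : `|r * cos (th x) - 1| <= 5 * q * B x ^+ 4.
Proof.
have := @exact_re_near1 R mu rho kappa k q x (B x) rho_ge0 rho_le1
  (ltW q_gt0) q_le1 erefl (B_ge1 x) (kappa_le x) (mu_le x) (x_le x).
by move=> /le_trans; apply; rewrite -mulrA [B x ^+ 4 * _]mulrC.
Qed.

Let E2_le x : `|r * sin (th x)| <= 5 * q * B x ^+ 4.
Proof.
have := @exact_im_near0 R mu rho kappa k q x (B x) rho_ge0 rho_le1
  (ltW q_gt0) q_le1 erefl (B_ge1 x) (kappa_le x) (mu_le x) (x_le x).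
by move=> /le_trans; apply; rewrite -mulrA [B x ^+ 4 * _]mulrC.
Qed.

Let measurable_A1 : measurable_fun setT A1.
Proof.
apply: measurable_funB => //; apply: measurable_funM => //.
by apply: measurable_funD => //; apply: measurable_funM.
Qed.

Let measurable_A2 : measurable_fun setT A2.
Proof.
apply: measurableT_comp => //; apply: measurable_funM => //.
by apply: measurable_funD => //; apply: measurable_funM.
Qed.

Let measurable_th : measurable_fun setT th.
Proof.
by apply: measurable_funM => //; apply: measurable_funD.
Qed.

Let measurable_E1 : measurable_fun setT (fun x => r * cos (th x)).
Proof.
apply: measurable_funM => //; apply: measurableT_comp measurable_th.
exact: (continuous_measurable_fun (@continuous_cos R)).
Qed.

Let measurable_E2 : measurable_fun setT (fun x => r * sin (th x)).
Proof.
apply: measurable_funM => //; apply: measurableT_comp measurable_th.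
exact: (continuous_measurable_fun (@continuous_sin R)).
Qed.

Let integrable_pow (F : R -> R) C n : measurable_fun setT F -> 0 <= C ->
  (forall x, `|F x| <= C * B x ^+ n.+1) -> nu.-integrable setT (EFin \o F).
Proof.
move=> mF C0 hF.
apply: (@integrable_dominated_gauss_weight _ _ _ _ (C * moment_const mu kappa n)) => // x.
by rewrite (le_trans (hF x))// -mulrA ler_wpM2l.
Qed.

Let integral_sym_le (F : R -> R) C C' n :
  measurable_fun setT F -> 0 <= C -> 0 <= C' ->
  (forall x, `|F x| <= C * B x ^+ n.+1) ->
  (forall x, `|F x + F (- x)| <= 2 * (C' * B x ^+ n.+1)) ->
  `|\int[nu]_x F x| <= 2 * (C' * moment_const mu kappa n).
Proof.
move=> mF C0 C'0 hF hF'.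
apply: (@norm_Rintegral_gauss_sym_le _ _ _ _ (C * moment_const mu kappa n)) => // x.
  by rewrite (le_trans (hF x))// -mulrA ler_wpM2l.
by rewrite (le_trans (hF' x))// ler_pM2l// -mulrA ler_wpM2l.
Qed.


Let r_ge0 : 0 <= r. Proof. exact: expR_ge0. Qed.

Let r_le1 : r <= 1.
Proof.
rewrite -expR0 ler_expR oppr_le0 mulr_ge0 ?sqr_ge0// mulr_ge0 ?sqr_ge0//.
by rewrite mulr_ge0 ?subr_ge0.
Qed.

Let AE1 x : A1 x = D1 x + r * cos (th x).
Proof. by rewrite /D1 /err_re subrK. Qed.

Let AE2 x : A2 x = D2 x - r * sin (th x).
Proof. by rewrite /D2 /err_im addrK. Qed.

Let E1_le1 x : `|r * cos (th x)| <= 1.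
Proof.
by rewrite -[leRHS]mul1r; apply: norm_mul_le (cos_max _); rewrite ger0_norm.
Qed.

Let E2_le1 x : `|r * sin (th x)| <= 1.
Proof.
by rewrite -[leRHS]mul1r; apply: norm_mul_le (sin_max _); rewrite ger0_norm.
Qed.

(** The size of A seen as (A - E) + E with |E| <= 1; it serves integrability. *)
Let crude : R := 20 * (q * delta) + 1.

Let crude_ge0 : 0 <= crude.
Proof. by rewrite addr_ge0// !mulr_ge0// ltW. Qed.

Let one_le_BX x n : 1 <= B x ^+ n.
Proof. exact: exprn_ege1. Qed.

Let A1_le x : `|A1 x| <= crude * B x ^+ 8.
Proof.
rewrite AE1 /crude mulrDl mul1r; apply: norm_add_le; first exact: D1_le.
exact: le_trans (E1_le1 x) _.
Qed.

Let A2_le x : `|A2 x| <= crude * B x ^+ 8.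
Proof.
rewrite AE2 /crude mulrDl mul1r; apply: norm_add_le; first exact: D2_le.
by rewrite normrN; exact: le_trans (E2_le1 x) _.
Qed.

Lemma step_re_integrable : nu.-integrable setT (EFin \o A1).
Proof. exact: integrable_pow measurable_A1 crude_ge0 A1_le. Qed.

Lemma step_im_integrable : nu.-integrable setT (EFin \o A2).
Proof. exact: integrable_pow measurable_A2 crude_ge0 A2_le. Qed.

Let AA := step_sqr mu rho kappa k h.
Let F := step_cross_re mu rho kappa k h.
Let G := step_cross_im mu rho kappa k h.

Let AAE x : AA x = A1 x ^+ 2 + A2 x ^+ 2. Proof. by []. Qed.

Let FE x : F x = A1 x * (r * cos (th x)) - A2 x * (r * sin (th x)).
Proof. by []. Qed.

Let GE x : G x = A1 x * (r * sin (th x)) + A2 x * (r * cos (th x)).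
Proof. by []. Qed.

Lemma step_sqr_integrable : nu.-integrable setT (EFin \o AA).
Proof.
apply: (@integrable_pow _ (crude ^+ 2 + crude ^+ 2) 15).
- by apply: measurable_funD; apply: measurable_funX.
- by rewrite addr_ge0 ?sqr_ge0.
move=> x; rewrite AAE mulrDl (_ : B x ^+ 16 = (B x ^+ 8) ^+ 2); last by rewrite -exprM.
by rewrite -!exprMn; apply: norm_add_le; apply: norm_exp_le.
Qed.

Lemma step_cross_re_integrable : nu.-integrable setT (EFin \o F).
Proof.
apply: (@integrable_pow _ (crude + crude) 7).
- by apply: measurable_funB; apply: measurable_funM.
- by rewrite addr_ge0.
move=> x; rewrite mulrDl -(mulr1 (crude * _)) FE; apply: norm_add_le.
  exact: norm_mul_le.
by rewrite normrN; exact: norm_mul_le.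
Qed.

Lemma step_cross_im_integrable : nu.-integrable setT (EFin \o G).
Proof.
apply: (@integrable_pow _ (crude + crude) 7).
- by apply: measurable_funD; apply: measurable_funM.
- by rewrite addr_ge0.
move=> x; rewrite mulrDl -(mulr1 (crude * _)) GE; apply: norm_add_le.
  exact: norm_mul_le.
exact: norm_mul_le.
Qed.

Let measurable_D1 : measurable_fun setT D1.
Proof. exact: measurable_funB. Qed.

Let measurable_D2 : measurable_fun setT D2.
Proof. exact: measurable_funD. Qed.

Let integrable_cst_nu (t : R) : nu.-integrable setT (EFin \o cst t).
Proof. exact: finite_measure_integrable_cst. Qed.

(** Pointwise the combination is |A - E|^2, at most 2 * 20^2 q^2 delta^2 B^16. The final factor 2
    comes from the mean of the Gaussian weight. *)
Lemma step_second_diff :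
  `|\int[nu]_x AA x - 2 * \int[nu]_x F x + r ^+ 2|
    <= 1600 * moment_const mu kappa 15 * k * delta ^+ 2.
Proof.
have iF := step_cross_re_integrable; have iA := step_sqr_integrable.
have i2F : nu.-integrable setT (EFin \o (fun x => 2 * F x)).
  exact: eq_integrable (integrableZl measurableT 2 iF).
have iB : nu.-integrable setT (EFin \o (fun x => AA x - 2 * F x)).
  exact: eq_integrable (integrableB measurableT iA i2F).
rewrite -RintegralZl// -RintegralB//.
rewrite -(Rintegral_probability_cst nu (r ^+ 2)).
rewrite -RintegralD//.
have -> : \int[nu]_x (AA x - 2 * F x + cst (r ^+ 2) x)
    = \int[nu]_x (D1 x ^+ 2 + D2 x ^+ 2).
  apply: eq_Rintegral => x _; rewrite AAE FE AE1 AE2 /=.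
  have -> : r ^+ 2 = r ^+ 2 * (cos (th x) ^+ 2 + sin (th x) ^+ 2).
    by rewrite cos2Dsin2 mulr1.
  ring.
have hb x : `|D1 x ^+ 2 + D2 x ^+ 2|
    <= 800 * (q ^+ 2 * delta ^+ 2) * B x ^+ 16.
  apply: le_trans (norm_add_le (norm_exp_le 2 (D1_le x))
    (norm_exp_le 2 (D2_le x))) _.
  rewrite (_ : B x ^+ 16 = (B x ^+ 8) ^+ 2); last by rewrite -exprM.
  by rewrite le_eqVlt; apply/orP; left; apply/eqP; ring.
have c0 : 0 <= 800 * (q ^+ 2 * delta ^+ 2).
  by apply: mulr_ge0; [exact: ler0n|apply: mulr_ge0; exact: sqr_ge0].
(* No cancellation is sought: the square is already of order k, and the symmetrised bound is twice
   the pathwise one. *)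
have hs x : `|D1 x ^+ 2 + D2 x ^+ 2 + (D1 (- x) ^+ 2 + D2 (- x) ^+ 2)|
    <= 2 * (800 * (q ^+ 2 * delta ^+ 2) * B x ^+ 16).
  rewrite mulr_natl mulr2n; apply: norm_add_le; first exact: hb.
  by have := hb (- x); rewrite B_N.
apply: le_trans (@integral_sym_le _ _ _ 15 _ c0 c0 hb hs) _.
  by apply: measurable_funD; apply: measurable_funX.
by rewrite -/k le_eqVlt; apply/orP; left; apply/eqP; ring.
Qed.

Let prod_le (u v : R) x : `|u| <= 20 * (q * delta) * B x ^+ 8 ->
  `|v| <= 5 * q * B x ^+ 4 -> `|u * v| <= 100 * (q ^+ 2 * delta) * B x ^+ 12.
Proof.
move=> hu hv; apply: le_trans (norm_mul_le hu hv) _.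
rewrite (_ : B x ^+ 12 = B x ^+ 8 * B x ^+ 4); last by rewrite -exprD.
by rewrite le_eqVlt; apply/orP; left; apply/eqP; ring.
Qed.

(** U is a part of A - E, pathwise of order q delta only and improved by symmetry. V and W are
    products of such a part with a part of E - 1 and have order q^2 delta outright. *)
Let integral_cross_le (U V W : R -> R) :
  measurable_fun setT (fun x => U x + V x + W x) ->
  (forall x, `|U x| <= 20 * (q * delta) * B x ^+ 8) ->
  (forall x, `|U x + U (- x)| <= 40 * (q ^+ 2 * delta) * B x ^+ 8) ->
  (forall x, `|V x| <= 100 * (q ^+ 2 * delta) * B x ^+ 12) ->
  (forall x, `|W x| <= 100 * (q ^+ 2 * delta) * B x ^+ 12) ->
  `|\int[nu]_x (U x + V x + W x)| <= 440 * moment_const mu kappa 11 * (k * delta).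
Proof.
move=> mUVW hU hUs hV hW.
have q0 := ltW q_gt0.
have qd0 : 0 <= q * delta by exact: mulr_ge0.
have q2d0 : 0 <= q ^+ 2 * delta by rewrite mulr_ge0 ?sqr_ge0.
have hb x : `|U x + V x + W x|
    <= (20 * (q * delta) + 200 * (q ^+ 2 * delta)) * B x ^+ 12.
  have := norm_add_le (norm_add_le (hU x) (hV x)) (hW x).
  have := ler_wpM2l qd0 (B_mono x (isT : (8 <= 12)%N)).
  move: (B x ^+ 8) (B x ^+ 12) => b8 b12 ? /le_trans; apply; lra.
have hs x : `|U x + V x + W x + (U (- x) + V (- x) + W (- x))|
    <= 2 * (220 * (q ^+ 2 * delta) * B x ^+ 12).
  have hVN := hV (- x); have hWN := hW (- x); rewrite B_N in hVN hWN.
  rewrite (_ : _ + _ = U x + U (- x) + (V x + V (- x)) + (W x + W (- x)));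
    last by ring.
  have := norm_add_le (norm_add_le (hUs x) (norm_add_le (hV x) hVN))
    (norm_add_le (hW x) hWN).
  have := ler_wpM2l q2d0 (B_mono x (isT : (8 <= 12)%N)).
  move: (B x ^+ 8) (B x ^+ 12) => b8 b12 ? /le_trans; apply; lra.
apply: le_trans (@integral_sym_le _ _ _ 11 mUVW _ _ hb hs) _.
- by apply: addr_ge0; (apply: mulr_ge0; [exact: ler0n|]).
- by apply: mulr_ge0; [exact: ler0n|].
- by rewrite -/k le_eqVlt; apply/orP; left; apply/eqP; ring.
Qed.

(** The splitting is (A - E) conj(E) = (A - E) + (A - E)(conj(E) - 1). The constant 880 is 440 for
    each of the real and imaginary parts. *)
Lemma step_first_diff :
  normc ((\int[nu]_x F x +i* \int[nu]_x G x) - (r ^+ 2)%:C)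
    <= 880 * moment_const mu kappa 11 * k * delta.
Proof.
have iF := step_cross_re_integrable; have iG := step_cross_im_integrable.
have -> : 880 * moment_const mu kappa 11 * k * delta =
    440 * moment_const mu kappa 11 * (k * delta)
    + 440 * moment_const mu kappa 11 * (k * delta).
  by ring.
apply: le_trans (normc_le_ReIm _) _; rewrite /= subr0.
apply: lerD.
  rewrite -(Rintegral_probability_cst nu (r ^+ 2)) -RintegralB//.
  have -> : \int[nu]_x (F x - cst (r ^+ 2) x) = \int[nu]_x (D1 x +
      D1 x * (r * cos (th x) - 1) + - (D2 x * (r * sin (th x)))).
    apply: eq_Rintegral => x _; rewrite FE AE1 AE2 /=.
    have -> : r ^+ 2 = r ^+ 2 * (cos (th x) ^+ 2 + sin (th x) ^+ 2).
      by rewrite cos2Dsin2 mulr1.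
    ring.
  apply: integral_cross_le => // [|x|x].
  - apply: measurable_funD; last by apply: measurableT_comp => //; apply: measurable_funM.
    apply: measurable_funD => //; apply: measurable_funM => //.
    exact: measurable_funB.
  - exact: prod_le.
  - by rewrite normrN; exact: prod_le.
have -> : \int[nu]_x G x = \int[nu]_x (D2 x +
    D2 x * (r * cos (th x) - 1) + D1 x * (r * sin (th x))).
  apply: eq_Rintegral => x _; rewrite GE AE1 AE2 /=; ring.
apply: integral_cross_le => // [|x|x].
- apply: measurable_funD; last exact: measurable_funM.
  apply: measurable_funD => //; apply: measurable_funM => //.
  exact: measurable_funB.
- exact: prod_le.
- exact: prod_le.
Qed.

End one_step.

(** * Mean-square bound after N steps *)

Section mean_square.
Variables (R : realType) (mu rho kappa q h : R).
Hypotheses (rho_ge0 : 0 <= rho) (rho_le1 : rho <= 1).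
Hypotheses (q_gt0 : 0 < q) (q_le1 : q <= 1) (h_gt0 : 0 < h) (h_le1 : h <= 1).

Let k := q ^+ 2.
Notation nu := (normal_prob 0 q).

(** One L must serve both hypotheses of [error_recursion], hence the sum of the two one-step
    constants. *)
Definition rate_const : R :=
  1600 * moment_const mu kappa 15 + 880 * moment_const mu kappa 11.

Definition mean_square_const (T : R) : R :=
  T * (rate_const * (6 * T * rate_const * expR (8 * rate_const * T) + 1)
       * expR (8 * rate_const * T)).

Let moment_ge0 n : 0 <= moment_const mu kappa n.
Proof. by rewrite exprn_ge0// mulr_ge0// !addr_ge0. Qed.

Let moment15_ge0 : 0 <= 1600 * moment_const mu kappa 15.
Proof. by apply: mulr_ge0; [exact: ler0n|]. Qed.

Let moment11_ge0 : 0 <= 880 * moment_const mu kappa 11.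
Proof. by apply: mulr_ge0; [exact: ler0n|]. Qed.

Lemma mean_square_const_ge0 T : 0 <= T -> 0 <= mean_square_const T.
Proof.
have L0 : 0 <= rate_const by exact: addr_ge0.
move=> T0; rewrite /mean_square_const; move: rate_const L0 => L L0.
by rewrite !mulr_ge0 ?expR_ge0// addr_ge0// !mulr_ge0 ?expR_ge0.
Qed.

Lemma mean_square_le (N : nat) :
  (\int[nu]_x step_sqr mu rho kappa k h x) ^+ N
  - 2 * complex.Re ((\int[nu]_x step_cross_re mu rho kappa k h x +i*
                     \int[nu]_x step_cross_im mu rho kappa k h x) ^+ N)
  + (damping rho kappa k ^+ 2) ^+ N
  <= mean_square_const (N%:R * k) * (k + h ^+ 2) ^+ 2.
Proof.
have k0 : 0 <= k by exact: sqr_ge0.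
have d0 : 0 <= k + h ^+ 2 by rewrite addr_ge0 ?sqr_ge0.
have d2 : k + h ^+ 2 <= 2.
  rewrite -[2]/(1 + 1) lerD// exprn_ile1// ltW//.
have L0 : 0 <= rate_const by exact: addr_ge0.
have a0 : 0 <= \int[nu]_x step_sqr mu rho kappa k h x.
  by apply: Rintegral_ge0 => x _; rewrite addr_ge0 ?sqr_ge0.
have c0 : 0 <= damping rho kappa k ^+ 2 by exact: sqr_ge0.
have c1 : damping rho kappa k ^+ 2 <= 1.
  rewrite exprn_ile1 ?expR_ge0// -expR0 ler_expR oppr_le0.
  by rewrite mulr_ge0// mulr_ge0 ?sqr_ge0// mulr_ge0 ?subr_ge0.
have h2 := step_second_diff mu kappa rho_ge0 rho_le1 q_gt0 q_le1 h_gt0.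
have h1 := step_first_diff mu kappa rho_ge0 rho_le1 q_gt0 q_le1 h_gt0.
have := @error_recursion R _ _ (\int[nu]_x step_cross_re mu rho kappa k h x +i*
  \int[nu]_x step_cross_im mu rho kappa k h x) _ k _ L0 k0 d0 d2 a0 c0 c1 _ _ N.
rewrite /mean_square_const [X in _ -> _ <= X]mulrAC; apply.
- apply: le_trans h2 _; rewrite !ler_wpM2r ?sqr_ge0//.
  by rewrite /rate_const lerDl.
- apply: le_trans h1 _; rewrite !ler_wpM2r//.
  by rewrite /rate_const lerDr.
Qed.

End mean_square.

(** * Numerical and exact amplitudes as products of one-step factors *)

Lemma cexp0 (R : realType) : cexp (0 : R[i]) = 1.
Proof. by rewrite /= expR0 cos0 sin0 mulr1 mulr0. Qed.

Definition step_factor (R : realType) (mu rho kappa k h x : R) : R[i] :=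
  step_re rho kappa k h x +i* step_im mu rho kappa k h x.

Definition exact_factor (R : realType) (mu rho kappa k x : R) : R[i] :=
  (damping rho kappa k * cos (phase mu rho kappa k x)) -i*
  (damping rho kappa k * sin (phase mu rho kappa k x)).

Lemma milstein_fourier_step (R : realType) (mu rho kappa k h : R)
    (z : nat -> R) (g : nat -> R[i]) : 0 <= rho -> 0 <= k -> 0 < h ->
  milstein_scheme mu rho k h z (fun n j => fourier_mode kappa h (g n) j) ->
  forall n, g n.+1 =
    g n * step_factor mu rho kappa k h (Num.sqrt k * z n).
Proof.
(* At j = 0 the mode equals its amplitude, so this grid point determines the multiplier. *)
move=> rho0 k0 h0 scheme n; have := scheme n 0.
rewrite /fourier_mode add0r sub0r !rmorphN /=.
rewrite mulr0z mulr0 mul0r cos0 expR0 sin0 mulr1z !mulr1 mulrN1 mulNr cosN sinN.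
rewrite !mul1r -[1 +i* 0]/(1 : R[i]) !mulr1 => ->.
rewrite /step_factor /step_re /step_im /sin_symbol /cos_symbol.
rewrite sqrtrM// exprMn sqr_sqrtr//.
case: (g n) => a b; apply/eqP; rewrite eq_complex /=.
by apply/andP; split; apply/eqP; field; rewrite gt_eqF.
Qed.

Lemma exact_amplitude_prod (R : realType) (mu rho kappa k : R) (g0 : R[i])
    (x : nat -> R) (n : nat) :
  exact_amplitude mu rho kappa g0 (n%:R * k) (\sum_(j < n) x j)
  = g0 * \prod_(j < n) exact_factor mu rho kappa k (x j).
Proof.
rewrite /exact_amplitude; congr (_ * _).
elim: n => [|n IH].
  by rewrite !big_ord0 mul0r !mulr0 addr0 mulr0 oppr0 -cexp0; congr cexp.
rewrite big_ord_recr [RHS]big_ord_recr /= -IH /exact_factor /damping /phase.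
have -> : n.+1%:R = n%:R + 1 :> R by rewrite natr1.
have -> : expR (- (2^-1 * (1 - rho) * kappa ^+ 2 * ((n%:R + 1) * k))) =
  expR (- (2^-1 * (1 - rho) * kappa ^+ 2 * (n%:R * k))) *
  expR (- (2^-1 * (1 - rho) * kappa ^+ 2 * k)).
  by rewrite -expRD; congr expR; ring.
have -> : - (kappa * (mu * ((n%:R + 1) * k) +
     Num.sqrt rho * (\sum_(j < n) x j + x n))) =
   - (kappa * (mu * (n%:R * k) + Num.sqrt rho * (\sum_(j < n) x j))) +
   - (kappa * (mu * k + Num.sqrt rho * x n)) by ring.
rewrite cosD sinD.
by apply/eqP; rewrite eq_complex /= !cosN !sinN; apply/andP; split; apply/eqP; ring.
Qed.

(** This is |u - v|^2 = |u|^2 - 2 Re(u conj v) + |v|^2 for products u and v. The term |u|^2 is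
    written as a complex product of real factors so that [expectation_complex_prod] covers it too;
    |v|^2 is deterministic. *)
Lemma normc_sqr_prodB (R : realType) (mu rho kappa k h : R) (x : nat -> R)
    (n : nat) :
  normc (\prod_(j < n) step_factor mu rho kappa k h (x j)
         - \prod_(j < n) exact_factor mu rho kappa k (x j)) ^+ 2
  = complex.Re (\prod_(j < n) (step_sqr mu rho kappa k h (x j) +i* 0))
    - 2 * complex.Re (\prod_(j < n) (step_cross_re mu rho kappa k h (x j) +i*
                                     step_cross_im mu rho kappa k h (x j)))
    + (damping rho kappa k ^+ 2) ^+ n.
Proof.
have uE : complex.Re (\prod_(j < n) (step_sqr mu rho kappa k h (x j) +i* 0))
    = normc (\prod_(j < n) step_factor mu rho kappa k h (x j)) ^+ 2.
  rewrite -(rmorph_prod (real_complex R)) /=.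
  elim: n => [|m IH]; first by rewrite !big_ord0 normc1 expr1n.
  rewrite !big_ord_recr /= IH normcM exprMn; congr (_ * _).
  by rewrite normc_sqr.
have vE : (damping rho kappa k ^+ 2) ^+ n
    = normc (\prod_(j < n) exact_factor mu rho kappa k (x j)) ^+ 2.
  elim: n {uE} => [|m IH]; first by rewrite big_ord0 normc1 expr1n.
  rewrite !big_ord_recr /= exprSr IH normcM exprMn; congr (_ * _).
  rewrite normc_sqr /= sqrrN !exprMn -mulrDr cos2Dsin2.
  by rewrite mulr1.
rewrite uE vE.
have -> : \prod_(j < n) (step_cross_re mu rho kappa k h (x j) +i*
    step_cross_im mu rho kappa k h (x j))
  = \prod_(j < n) step_factor mu rho kappa k h (x j) *
    (\prod_(j < n) exact_factor mu rho kappa k (x j))^*%C.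
  rewrite rmorph_prod -big_split /=; apply: eq_bigr => j _.
  apply/eqP; rewrite eq_complex /= /step_cross_re /step_cross_im.
  by apply/andP; split; apply/eqP; ring.
move: (\prod_(j < n) step_factor _ _ _ _ _ _) => u.
move: (\prod_(j < n) exact_factor _ _ _ _ _) => v.
rewrite !normc_sqr; case: u v => a b [c d] /=; ring.
Qed.

(** * Brownian increments *)

Section brownian_expectation.
Context d (Omega : measurableType d) (R : realType) (P : probability Omega R).
Variables (M : R -> {RV P >-> R}) (BM : standard_brownian_motion P M).
Variables (mu rho kappa k h : R) (g0 : R[i]) (N : nat).
Hypotheses (rho_ge0 : 0 <= rho) (rho_le1 : rho <= 1).
Hypotheses (k_gt0 : 0 < k) (k_le1 : k <= 1) (h_gt0 : 0 < h) (h_le1 : h <= 1).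

Let X (n : nat) (w : Omega) := M (n.+1%:R * k) w - M (n%:R * k) w.
Let q := Num.sqrt k.
Notation nu := (normal_prob 0 q).

Let q_gt0 : 0 < q. Proof. by rewrite sqrtr_gt0. Qed.
Let q_le1 : q <= 1. Proof. by rewrite -[leRHS]sqrtr1 ler_sqrt. Qed.
Let kE : q ^+ 2 = k. Proof. by rewrite sqr_sqrtr// ltW. Qed.

Let mX n : measurable_fun setT (X n).
Proof. exact: measurable_funB. Qed.

Let indepX : mutually_independent P X.
Proof.
case: BM => _ indep _ _; apply: (indep (fun n => n%:R * k)).
  by rewrite mul0r.
by move=> m n mn; rewrite ler_pM2r// ler_nat.
Qed.

Let lawX n A : measurable A -> P (X n @^-1` A) = nu A.
Proof.
case: BM => _ _ law _ mA.
have lt : n%:R * k < n.+1%:R * k by rewrite ltr_pM2r// ltr_nat.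
have n0 : 0 <= n%:R * k by rewrite mulr_ge0// ltW.
have dk : n.+1%:R * k - n%:R * k = k by rewrite -natr1; ring.
have := law _ _ n0 lt A mA.
rewrite dk.
exact.
Qed.

Let sumX w : \sum_(j < N) X j w = M (N%:R * k) w - M 0 w.
Proof.
rewrite -(big_mkord xpredT (fun j => X j w)) /X.
by rewrite (telescope_sumr (fun j => M (j%:R * k) w))// mul0r.
Qed.

Let S w := \prod_(j < N) step_factor mu rho kappa k h (X j w).

Let U w := complex.Re (\prod_(j < N) (step_sqr mu rho kappa k h (X j w) +i* 0)).
Let V w := complex.Re (\prod_(j < N) (step_cross_re mu rho kappa k h (X j w) +i*
                                      step_cross_im mu rho kappa k h (X j w))).

Let err w : R :=
  normc (g0 * S w - exact_amplitude mu rho kappa g0 (N%:R * k)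
                      (M (N%:R * k) w)) ^+ 2.

(** The error agrees only almost surely with the integrable function to which it will be compared,
    so its measurability needs its own proof. For the product of step factors it is read off
    integrability. *)
Let measurable_err : measurable_fun setT err.
Proof.
have i1 := step_re_integrable mu kappa rho_ge0 rho_le1 q_gt0 q_le1 h_gt0.
have i2 := step_im_integrable mu kappa rho_ge0 rho_le1 q_gt0 q_le1 h_gt0.
rewrite kE in i1 i2.
have [/measurable_int mRe /measurable_int mIm _] :=
  @expectation_complex_prod _ _ _ P nu X mX indepX lawX _ _ N i1 i2.
have {}mRe : measurable_fun setT (fun w => complex.Re (S w)).
  exact/measurable_EFinP.
have {}mIm : measurable_fun setT (fun w => complex.Im (S w)).
  exact/measurable_EFinP.
pose t := N%:R * k.
pose ph w := - (kappa * (mu * t + Num.sqrt rho * M t w)).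
have mph : measurable_fun setT ph.
  by apply: measurableT_comp => //; apply: measurable_funM => //;
    apply: measurable_funD => //; apply: measurable_funM.
have mcos : measurable_fun setT (fun w => cos (ph w)).
  apply: measurableT_comp mph.
  exact: (continuous_measurable_fun (@continuous_cos R)).
have msin : measurable_fun setT (fun w => sin (ph w)).
  apply: measurableT_comp mph.
  exact: (continuous_measurable_fun (@continuous_sin R)).
pose r := expR (- (2^-1 * (1 - rho) * kappa ^+ 2 * t)).
have -> : err = fun w =>
   (complex.Re g0 * complex.Re (S w) - complex.Im g0 * complex.Im (S w) -
    (complex.Re g0 * (r * cos (ph w)) - complex.Im g0 * (r * sin (ph w)))) ^+ 2
 + (complex.Re g0 * complex.Im (S w) + complex.Im g0 * complex.Re (S w) -
    (complex.Re g0 * (r * sin (ph w)) + complex.Im g0 * (r * cos (ph w)))) ^+ 2.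
  apply/funext => w; rewrite /err normc_sqr /exact_amplitude /=.
  by case: g0 => a b; case: (S w) => u v.
apply: measurable_funD; apply: measurable_funX;
  (apply: measurable_funB; [apply: measurable_funB|]) ||
  (apply: measurable_funB; apply: measurable_funD);
  do ?[apply: measurable_funB|apply: measurable_funD|apply: measurable_funM] => //.
Qed.

Lemma mean_square_error_le :
  (\int[P]_w (err w)%:E <=
   (normc g0 ^+ 2 * (mean_square_const mu kappa (N%:R * k)
      * (k + h ^+ 2) ^+ 2))%:E)%E.
Proof.
have iA := step_sqr_integrable mu kappa rho_ge0 rho_le1 q_gt0 q_le1 h_gt0.
have iF := step_cross_re_integrable mu kappa rho_ge0 rho_le1 q_gt0 q_le1 h_gt0.
have iG := step_cross_im_integrable mu kappa rho_ge0 rho_le1 q_gt0 q_le1 h_gt0.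
have i0 : nu.-integrable setT (EFin \o cst (0 : R)).
  exact: finite_measure_integrable_cst.
have mean := mean_square_le mu kappa rho_ge0 rho_le1 q_gt0 q_le1 h_gt0 h_le1 N.
rewrite kE in iA iF iG mean.
have [iU _ eU] := @expectation_complex_prod _ _ _ P nu X mX indepX lawX _ _ N iA i0.
have [iV _ eV] := @expectation_complex_prod _ _ _ P nu X mX indepX lawX _ _ N iF iG.
have {}eU : \int[P]_w U w = (\int[nu]_x step_sqr mu rho kappa k h x) ^+ N.
  have /(congr1 (@complex.Re R)) /= := eU.
  rewrite (_ : \int[nu]_x 0 = 0); last by rewrite /Rintegral integral0.
  by rewrite -[_ +i* 0]/((_)%:C) -(rmorphXn (real_complex R)) /=.
have {}eV : \int[P]_w V w = complex.Re
    ((\int[nu]_x step_cross_re mu rho kappa k h x +i*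
      \int[nu]_x step_cross_im mu rho kappa k h x) ^+ N).
  by have /(congr1 (@complex.Re R)) := eV.
pose c := (damping rho kappa k ^+ 2) ^+ N.
pose H w := normc g0 ^+ 2 * (U w - 2 * V w + c).
have ic : P.-integrable setT (EFin \o cst c).
  exact: finite_measure_integrable_cst.
have i2V : P.-integrable setT (EFin \o (fun w => 2 * V w)).
  exact: eq_integrable (integrableZl measurableT 2 iV).
have iUV : P.-integrable setT (EFin \o (fun w => U w - 2 * V w)).
  exact: eq_integrable (integrableB measurableT iU i2V).
have iUVc : P.-integrable setT (EFin \o (fun w => U w - 2 * V w + c)).
  exact: eq_integrable (integrableD measurableT iUV ic).
have iH : P.-integrable setT (EFin \o H).
  exact: eq_integrable (integrableZl measurableT (normc g0 ^+ 2) iUVc).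
have -> : (\int[P]_w (err w)%:E = \int[P]_w (H w)%:E)%E.
  apply: ae_eq_integral => //.
  - exact/measurable_EFinP.
  - exact: measurable_int iH.
  have [M0 _ _ _] := BM.
  (* The exact mode contains M at the final time, the product only increments; they match where M 0
     = 0, that is almost surely. *)
  apply: filterS M0 => w M0w _; congr EFin.
  have MN : M (N%:R * k) w = \sum_(j < N) X j w by rewrite sumX M0w subr0.
  rewrite /err /H MN (exact_amplitude_prod _ _ _ _ _ (fun j => X j w)).
  by rewrite -mulrBr normcM exprMn (normc_sqr_prodB _ _ _ _ _ (fun j => X j w)).
have -> : (\int[P]_w (H w)%:E = (\int[P]_w H w)%:E)%E.
  by rewrite /Rintegral fineK//; exact: integrable_fin_num iH.
rewrite lee_fin /H RintegralZl// ler_wpM2l ?sqr_ge0//.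
have cE : \int[P]_w c = c by exact: Rintegral_probability_cst.
by rewrite RintegralD// RintegralB// RintegralZl// cE eU eV.
Qed.

End brownian_expectation.

(** * Root-mean-square error at the final time *)

Unset Implicit Arguments.
Set Strict Implicit.

Theorem mainTheorem3 (R : realType) (mu rho T kappa : R) (g0 : R[i])
    (rho_ge0 : 0 <= rho) (rho_le1 : rho <= 1) (T_gt0 : 0 < T) :
  exists c k0 h0 : R, [/\ 0 < c, 0 < k0, 0 < h0 &
    forall (d : measure_display) (Omega : measurableType d)
      (P : probability Omega R) (M : R -> {RV P >-> R}),
    standard_brownian_motion P M ->
    forall (k h : R) (N : nat),
      0 < k -> k <= k0 -> T / k = N%:R -> 0 < h -> h <= h0 ->
    forall (Z : nat -> Omega -> R) (g : nat -> Omega -> R[i]),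
      (forall n w,
         Num.sqrt k * Z n w = M (n.+1%:R * k) w - M (n%:R * k) w) ->
      (forall w, g 0%N w = g0) ->
      (forall w, milstein_scheme mu rho k h (fun n => Z n w)
                   (fun n j => fourier_mode kappa h (g n w) j)) ->
      ('E_P[(fun w =>
          normc (g N w - exact_amplitude mu rho kappa g0 T (M T w)) ^+ 2)%R]
         `^ (2^-1)%R
       <= (c * (k + h ^+ 2))%:E)%E].
Proof.
pose C := normc g0 ^+ 2 * mean_square_const mu kappa T.
have C0 : 0 <= C.
  by rewrite mulr_ge0 ?sqr_ge0// mean_square_const_ge0// ltW.
(* The summand 1 keeps c positive when C vanishes, for instance for g0 = 0. The thresholds 1 yield q
   <= 1 and delta <= 2. *)
exists (Num.sqrt C + 1), 1, 1; split => //.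
move=> d Omega P M BM k h N k0 k1 TN h0 h1 Z g ZM g_0 scheme.
have TE : T = N%:R * k by rewrite -TN divfK// gt_eqF.
have gE n w : g n w = g0 * \prod_(j < n)
    step_factor mu rho kappa k h (M (j.+1%:R * k) w - M (j%:R * k) w).
  elim: n => [|n IH]; first by rewrite big_ord0 mulr1 g_0.
  rewrite big_ord_recr mulrA -IH /= -ZM.
  by rewrite (milstein_fourier_step rho_ge0 (ltW k0) h0 (scheme w)).
have d0 : 0 <= k + h ^+ 2 by rewrite addr_ge0 ?sqr_ge0// ltW.
have bound := mean_square_error_le BM mu kappa g0 N rho_ge0 rho_le1 k0 k1 h0 h1.
have E0 : (0 <= 'E_P[(fun w =>
    normc (g N w - exact_amplitude mu rho kappa g0 T (M T w)) ^+ 2)%R])%E.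
  by apply: expectation_ge0 => w; exact: sqr_ge0.
have {}bound : ('E_P[(fun w =>
    normc (g N w - exact_amplitude mu rho kappa g0 T (M T w)) ^+ 2)%R]
    <= (C * (k + h ^+ 2) ^+ 2)%:E)%E.
  rewrite unlock -mulrA TE; apply: le_trans bound.
  by rewrite le_eqVlt; apply/orP; left; apply/eqP; apply: eq_integral => w _;
    rewrite gE.
have Cd0 : 0 <= C * (k + h ^+ 2) ^+ 2 by rewrite mulr_ge0 ?sqr_ge0.
apply: (@le_trans _ _ ((C * (k + h ^+ 2) ^+ 2)%:E `^ (2^-1))%E).
  by apply: gt0_ler_poweR => //; rewrite in_itv/= leey andbT// lee_fin.
rewrite poweR_EFin lee_fin powR12_sqrt// sqrtrM// sqrtr_sqr ger0_norm//.
by rewrite ler_wpM2r// lerDl.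
Qed.
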